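(* Fix an orientation string $\delta=(\delta_1,\ldots,\delta_n)$. For every $\delta$-semistandard tableau $T$ of rectangular shape, $$\partial_{R^{n-1}(\delta)}\cdots\partial_{R(\delta)}\,\partial_\delta(T)=T,$$ where $\partial_\delta$ denotes $\delta$-promotion and $R(\delta)=(\delta_2,\ldots,\delta_n,\delta_1)$.
   Context: Young diagrams are in English notation (left-justified rows of weakly decreasing length from top to bottom). An orientation string is a sequence $\delta=(\delta_1,\ldots,\delta_n)$ with each $\delta_i\in\{\mathbf h,\mathbf v\}$. A horizontal strip is a set of cells no two of which lie in the same column; a vertical strip is a set of cells no two of which lie in the same row. A filling $T$ of a Young diagram with entries in $\{1,\ldots,n\}$ is a $\delta$-semistandard tableau if the entries weakly increase along rows (left to right) and down columns, and for each $i$ the cells containing $i$ form a horizontal strip if $\delta_i=\mathbf h$ and a vertical strip if $\delta_i=\mathbf v$. The content of $T$ is $\gamma=(\gamma_1,\ldots,\gamma_n)$, with $\gamma_i$ the number of cells containing $i$. Rotation of strings is $R(x_1,\ldots,x_n)=(x_2,\ldots,x_n,x_1)$. $\delta$-jeu-de-taquin: consider a dotted cell, with entry $a$ in the cell directly below and $b$ in the cell directly to the right. If $a\neq b$, exchange the dot with the smaller of $a$ and $b$. If $a=b$, exchange the dot with the entry below if $\delta_a=\mathbf h$ and with the entry to the right if $\delta_a=\mathbf v$. If only one of these two neighbouring cells exists and is undotted, exchange the dot with the entry of that cell; if neither exists as an undotted cell, the sliding of this dot is complete. $\delta$-promotion $\partial_\delta(T)$: replace all entries $1$ of $T$ by dots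 (these form a row if $\delta_1=\mathbf h$ and a column if $\delta_1=\mathbf v$). Apply $\delta$-jeu-de-taquin slides to completion to the dots one at a time, starting with the rightmost dot and proceeding leftward if $\delta_1=\mathbf h$, and starting with the lowest dot and proceeding upward if $\delta_1=\mathbf v$. Finally replace each dot by $n+1$ and subtract $1$ from every entry. If $T$ is $\delta$-semistandard of content $\gamma$, then $\partial_\delta(T)$ is an $R(\delta)$-semistandard tableau of the same shape and of content $R(\gamma)$. *)

(* Defs.v *)
From mathcomp Require Import all_boot.

Set Implicit Arguments.
Unset Strict Implicit.
Unset Printing Implicit Defensive.

Inductive orientation := Hor | Ver.

(* A cell (i, j) lies in row i (counted from the top) and column j (counted
   from the left), both numbered from 0; entries are numbered from 1. *)
Definition cell := (nat * nat)%type.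

(* A filling is the list of its rows, so its diagram is [shape T]. *)
Definition filling := seq (seq nat).

Definition cells (T : filling) : seq cell :=
  [seq (i, j) | i <- iota 0 (size T), j <- iota 0 (size (nth [::] T i))].

Definition entry (T : filling) (p : cell) : nat := nth 0 (nth [::] T p.1) p.2.

Definition cells_with (T : filling) (a : nat) : seq cell :=
  [seq p <- cells T | entry T p == a].

Definition horizontal_strip (s : seq cell) : Prop :=
  forall p q, p \in s -> q \in s -> p.2 = q.2 -> p = q.

Definition vertical_strip (s : seq cell) : Prop :=
  forall p q, p \in s -> q \in s -> p.1 = q.1 -> p = q.

(* The orientation delta_a of the entry a, for 1 <= a <= size delta. *)
Definition orient (delta : seq orientation) (a : nat) : orientation :=
  nth Hor delta a.-1.

Record semistandard (delta : seq orientation) (T : filling) : Prop := {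
  ss_diagram : sorted geq (shape T);
  ss_range : forall p, p \in cells T -> 1 <= entry T p <= size delta;
  ss_rows : forall p q, p \in cells T -> q \in cells T ->
    p.1 = q.1 -> p.2 <= q.2 -> entry T p <= entry T q;
  ss_columns : forall p q, p \in cells T -> q \in cells T ->
    p.2 = q.2 -> p.1 <= q.1 -> entry T p <= entry T q;
  ss_strips : forall a, 1 <= a <= size delta ->
    match orient delta a with
    | Hor => horizontal_strip (cells_with T a)
    | Ver => vertical_strip (cells_with T a)
    end
}.

(* [None] marks a dotted cell. *)
Definition dotted_filling := seq (seq (option nat)).

(* [None] if the cell is dotted or lies outside the diagram. *)
Definition dentry (D : dotted_filling) (p : cell) : option nat :=
  nth None (nth [::] D p.1) p.2.

Definition dset (D : dotted_filling) (p : cell) (x : option nat) :=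
  set_nth [::] D p.1 (set_nth None (nth [::] D p.1) p.2 x).

Definition exchange (D : dotted_filling) (p q : cell) : dotted_filling :=
  dset (dset D p (dentry D q)) q (dentry D p).

Definition below (p : cell) : cell := (p.1.+1, p.2).
Definition right_of (p : cell) : cell := (p.1, p.2.+1).

(* The cell with which the dot in p is to be exchanged, if any. *)
Definition jdt_target (delta : seq orientation) (D : dotted_filling)
    (p : cell) : option cell :=
  match dentry D (below p), dentry D (right_of p) with
  | Some a, Some b =>
      if a < b then Some (below p)
      else if b < a then Some (right_of p)
      else match orient delta a with
           | Hor => Some (below p)
           | Ver => Some (right_of p)
           end
  | Some _, None => Some (below p)
  | None, Some _ => Some (right_of p)
  | None, None => None
  end.

Definition jdt_step (delta : seq orientation) (s : dotted_filling * cell) :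
    dotted_filling * cell :=
  match jdt_target delta s.1 s.2 with
  | Some q => (exchange s.1 s.2 q, q)
  | None => s
  end.

(* The sliding is complete after the iterations below: each exchange increases
   i + j, where (i, j) is the position of the dot, and i < size D and
   j < size (flatten D) throughout. *)
Definition slide (delta : seq orientation) (D : dotted_filling) (p : cell) :
    dotted_filling :=
  (iter (size D + size (flatten D)) (jdt_step delta) (D, p)).1.

(* Rightmost cell first for [Hor], lowest cell first for [Ver]. *)
Definition slide_order (o : orientation) (s : seq cell) : seq cell :=
  match o with
  | Hor => sort (fun p q => q.2 <= p.2) s
  | Ver => sort (fun p q => q.1 <= p.1) s
  end.

Definition dot_ones (T : filling) : dotted_filling :=
  [seq [seq if x == 1 then None else Some x | x <- row] | row <- T].

Definition promotion (delta : seq orientation) (T : filling) : filling :=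
  let dots := slide_order (orient delta 1) (cells_with T 1) in
  let D := foldl (slide delta) (dot_ones T) dots in
  [seq [seq (odflt (size delta).+1 x).-1 | x <- row] | row <- D].

Definition rotate (delta : seq orientation) : seq orientation := rot 1 delta.

(* The composite of the first k promotions: that of delta is applied first,
   then that of R(delta), and so on up to that of R^(k-1)(delta). *)
Fixpoint promotions (delta : seq orientation) (k : nat) (T : filling) :
    filling :=
  match k with
  | 0 => T
  | k'.+1 => promotion (iter k' rotate delta) (promotions delta k' T)
  end.

(* Main.v *)
Require Import Defs.
From mathcomp Require Import all_boot zify.

Set Implicit Arguments.
Unset Strict Implicit.
Unset Printing Implicit Defensive.

(** The proof never standardizes: it applies the theory of jeu de taquin to the
alphabet 1, ..., n with the relation [orient_le delta], which is the usual order
except that a letter is related to itself when it is horizontal and not when it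
is vertical. This relation and its complement are both transitive, and the
rows of a delta-semistandard tableau are increasing for it while its columns,
read upwards, avoid it. Nothing else about the order is used in Knuth
equivalence, in Greene's invariants or in the slides.

A step of a delta-jeu-de-taquin slide either keeps the reading word (rows from
bottom to top) or changes it to a Knuth equivalent one ([word_step_below]).
Hence the word of the entries of T other than 1 is equivalent, up to a shift of
the letters, to the word of the entries of the promotion of T other than n
([promotion_mixed]). Knuth equivalence survives the restriction to an interval
of letters, so after k promotions the word of the entries of T greater than k
is equivalent to the word of the entries of the k-th iterate that are at most
n - k ([promotions_mixed]).

The largest number of letters that t increasing subsequences can cover, for
each t, is invariant under Knuth equivalence ([colourable_knuth]). In a
rectangle the entries at most n - k occupy a Young diagram and the entries
greater than k a Young diagram turned upside down; in both cases the maximum is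
the number of cells in the t longest rows: the rows themselves attain it, and
no increasing subsequence meets a column twice ([greene_interval]). So row i of
the k-th iterate has as many entries at most n - k as row r - 1 - i of T has
entries greater than k ([promotions_complement]). Applying this first to T with
k and then to the k-th iterate with n - k shows that the n-th iterate and T have,
in every row and for every k, the same number of entries at most k; hence they
are equal.

For the iteration one also has to know that a promotion of a delta-semistandard
tableau is semistandard for the rotated orientation. The new entries n form a
strip of the right kind because the paths of consecutive dots do not cross
([slides_noncrossing]). *)

(** * Mixed orders *)

Definition mixed_order (R : rel nat) :=
  transitive R /\ transitive (fun a b => ~~ R a b).

(** Transposing a tableau exchanges the row and column conditions, that is,
replaces the order by this one; so each statement about rows gives one about
columns. *)
Definition dual_order (R : rel nat) : rel nat := fun a b => ~~ R b a.

(** [orient_le delta a b] says that b may stand immediately to the right of a in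
a row; its failure in the form [~~ orient_le delta b a] says that b may stand
immediately below a in a column. *)
Definition orient_le (delta : seq orientation) : rel nat :=
  fun a b => if orient delta a is Hor then a <= b else a < b.

Lemma orient_le_leq delta a b : orient_le delta a b -> a <= b.
Proof. by rewrite /orient_le; case: orient => //; apply: ltnW. Qed.

Lemma orient_le_geq delta a b : ~~ orient_le delta a b -> b <= a.
Proof. by rewrite /orient_le; case: orient; lia. Qed.

Lemma orient_le_mixed delta : mixed_order (orient_le delta).
Proof.
by split=> b a c; rewrite /orient_le; case: (orient delta a);
  have [->|] := eqVneq a b; case: (orient delta b); lia.
Qed.

Lemma mixed_dual R : mixed_order R -> mixed_order (dual_order R).
Proof.
case=> R1 R2; split=> b a c; rewrite /dual_order.
  by move=> ba cb; apply: R2 cb ba.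
by rewrite !negbK => ba cb; apply: R1 cb ba.
Qed.

Lemma mixed_ltr R a y z : mixed_order R -> R a y -> ~~ R z y -> R a z.
Proof. by case=> _ R2 ay zy; apply: contraLR ay => az; apply: R2 az zy. Qed.

Lemma mixed_ltl R a y z : mixed_order R -> R y a -> ~~ R y z -> R z a.
Proof. by case=> _ R2 ya yz; apply: contraLR ya => za; apply: R2 yz za. Qed.

(** * Knuth equivalence *)

(** These are Knuth's moves for words with repetitions, where the weak
inequality is [R] and the strict inequality y < z is [~~ R z y]. *)
Inductive knuth (R : rel nat) : seq nat -> seq nat -> Prop :=
| Knuth1 u v x y z of R x y & ~~ R z y :
    knuth R (u ++ [:: x; z; y] ++ v) (u ++ [:: z; x; y] ++ v)
| Knuth2 u v x y z of ~~ R y x & R y z :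
    knuth R (u ++ [:: y; x; z] ++ v) (u ++ [:: y; z; x] ++ v)
| KnuthRefl w : knuth R w w
| KnuthSym w1 w2 : knuth R w1 w2 -> knuth R w2 w1
| KnuthTrans w1 w2 w3 : knuth R w1 w2 -> knuth R w2 w3 -> knuth R w1 w3.

Lemma knuth_cat R u v w1 w2 :
  knuth R w1 w2 -> knuth R (u ++ w1 ++ v) (u ++ w2 ++ v).
Proof.
elim=> [u' v' x y z xy zy|u' v' x y z yx yz|w|w3 w4 _|w3 w4 w5 _ IH1 _ IH2].
- by rewrite -!catA !(catA u u'); apply: Knuth1.
- by rewrite -!catA !(catA u u'); apply: Knuth2.
- exact: KnuthRefl.
- exact: KnuthSym.
- exact: KnuthTrans IH1 IH2.
Qed.

Lemma knuth_catl R u w1 w2 : knuth R w1 w2 -> knuth R (u ++ w1) (u ++ w2).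
Proof. by move/(knuth_cat u [::]); rewrite !cats0. Qed.

Lemma knuth_catr R v w1 w2 : knuth R w1 w2 -> knuth R (w1 ++ v) (w2 ++ v).
Proof. exact: (knuth_cat [::] v). Qed.

Lemma knuth_perm R w1 w2 : knuth R w1 w2 -> perm_eq w1 w2.
Proof.
elim=> [u v x y z _ _|u v x y z _ _|w|w3 w4 _|w3 w4 w5 _ IH1 _ IH2].
- by rewrite perm_cat2l perm_cat2r (perm_catCA [:: x] [:: z] [:: y]).
- by rewrite perm_cat2l perm_cat2r perm_cons (perm_catC [:: x] [:: z]).
- by [].
- by rewrite perm_sym.
- exact: perm_trans IH1 IH2.
Qed.

Lemma knuth_map R R' (f : nat -> nat) w1 w2 :
  knuth R w1 w2 ->
  {in w1 &, forall x y, R x y = R' (f x) (f y)} ->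
  knuth R' (map f w1) (map f w2).
Proof.
have sub (u v : seq nat) (x y z a : nat) :
    a \in [:: x; y; z] -> a \in u ++ [:: x; y; z] ++ v.
  by move=> xs; rewrite !mem_cat xs orbT.
elim=> [u v x y z xy zy|u v x y z yx yz|w|w3 w4 K IH|w3 w4 w5 K IH1 _ IH2] RR'.
- rewrite !map_cat /=; apply: Knuth1; rewrite -RR' ?sub ?inE ?eqxx ?orbT //.
- rewrite !map_cat /=; apply: Knuth2; rewrite -RR' ?sub ?inE ?eqxx ?orbT //.
- exact: KnuthRefl.
- apply: KnuthSym; apply: IH => x y xw yw.
  by apply: RR'; rewrite -(perm_mem (knuth_perm K)).
- apply: KnuthTrans (IH1 RR') _; apply: IH2 => x y xw yw.
  by apply: RR'; rewrite (perm_mem (knuth_perm K)).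
Qed.

(** The letter between x and z in a Knuth move is also between them in value, so
a convex set of letters keeps the whole move, or cuts it down to an equality. *)
Lemma knuth_filter (R : rel nat) (P : pred nat) w1 w2 :
  (forall x y z, R x y -> ~~ R z y -> P x -> P z -> P y) ->
  (forall x y z, ~~ R y x -> R y z -> P x -> P z -> P y) ->
  knuth R w1 w2 -> knuth R (filter P w1) (filter P w2).
Proof.
move=> P1 P2.
elim=> [u v x y z xy zy|u v x y z yx yz|w|w3 w4 _|w3 w4 w5 _ IH1 _ IH2].
- rewrite !filter_cat; have := P1 _ _ _ xy zy; rewrite /=.
  case: (P x); case: (P z) => /= Py; try exact: KnuthRefl.
  by rewrite Py //; apply: Knuth1.
- rewrite !filter_cat; have := P2 _ _ _ yx yz; rewrite /=.
  case: (P x); case: (P z) => /= Py; try exact: KnuthRefl.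
  by rewrite Py //; apply: Knuth2.
- exact: KnuthRefl.
- exact: KnuthSym.
- exact: KnuthTrans IH1 IH2.
Qed.

(** * Greene's invariants *)

Definition colour_class (cw : seq (nat * nat)) (a : nat) : seq nat :=
  [seq p.1 | p <- cw & p.2 == a].

Definition increasing_colouring (R : rel nat) (t : nat) cw :=
  forall a, a < t -> sorted R (colour_class cw a).

(** The colours below [t] mark t disjoint increasing subsequences; a letter with a
colour at least [t] is uncovered. Words are coloured by pairing their letters
with colours, so that a colouring follows the word through a move. *)
Definition colourable (R : rel nat) (t m : nat) (w : seq nat) :=
  exists cw, [/\ unzip1 cw = w, increasing_colouring R t cw
               & count (fun p : nat * nat => p.2 < t) cw = m].

Definition swap_colours (a b : nat) (cw : seq (nat * nat)) :=
  [seq (p.1, if p.2 == a then b else if p.2 == b then a else p.2) | p <- cw].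

Lemma swap_colours_unzip a b cw : unzip1 (swap_colours a b cw) = unzip1 cw.
Proof. by rewrite /unzip1 -map_comp. Qed.

Lemma swap_colours_count t a b cw : a < t -> b < t ->
  count (fun p : nat * nat => p.2 < t) (swap_colours a b cw) =
  count (fun p : nat * nat => p.2 < t) cw.
Proof.
move=> at_ bt; rewrite count_map; apply: eq_count => p /=.
by case: eqP => [->|_]; [rewrite at_|case: eqP => [->|//]; rewrite at_ bt].
Qed.

Lemma swap_colours_class a b d cw :
  colour_class (swap_colours a b cw) d =
  colour_class cw (if d == a then b else if d == b then a else d).
Proof.
rewrite /colour_class filter_map -map_comp; congr map.
by apply: eq_filter => p /=; repeat case: eqP => //=; lia.
Qed.

Lemma colour_class_cat cw1 cw2 a :
  colour_class (cw1 ++ cw2) a = colour_class cw1 a ++ colour_class cw2 a.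
Proof. by rewrite /colour_class filter_cat map_cat. Qed.

Lemma sorted_cat_cons (R : rel nat) s1 x s2 :
  sorted R (s1 ++ x :: s2) = sorted R (rcons s1 x) && path R x s2.
Proof. by case: s1 => [|h s] //=; rewrite cat_path rcons_path /= andbA. Qed.

Lemma sorted_rcons_weaken (R : rel nat) s y z :
  (forall a, R a y -> R a z) -> sorted R (rcons s y) -> sorted R (rcons s z).
Proof.
by case: s => //= h s yz; rewrite !rcons_path => /andP[-> /yz].
Qed.

Lemma path_weaken (R : rel nat) s y z :
  (forall a, R y a -> R z a) -> path R y s -> path R z s.
Proof. by case: s => //= h s yz /andP[/yz -> ->]. Qed.

Lemma unzip1_cat3 (cw : seq (nat * nat)) u x y z v :
  unzip1 cw = u ++ [:: x; y; z] ++ v ->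
  exists cu a b d cv, [/\ cw = cu ++ [:: (x, a); (y, b); (z, d)] ++ cv,
    unzip1 cu = u & unzip1 cv = v].
Proof.
elim: u cw => [|x' u IH] [|[w a] cw] //=.
  case: cw => [|[w' b] [|[w'' d] cv]] // [-> -> -> <-].
  by exists [::], a, b, d, cv.
case=> -> /IH[cu [a' [b [d [cv [-> <- <-]]]]]].
by exists ((x', a) :: cu), a', b, d, cv.
Qed.

(** A colouring is obstructed only when x and z carry the same colour, for then
their exchange breaks an increasing subsequence. In that case y takes the place
of z in this subsequence and z the place of y, and the two subsequences exchange
their tails; if y is uncovered, z becomes uncovered instead. *)
Lemma colourable_Knuth1 R t m u v x y z : mixed_order R ->
    R x y -> ~~ R z y ->
  colourable R t m (u ++ [:: x; z; y] ++ v) <->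
  colourable R t m (u ++ [:: z; x; y] ++ v).
Proof.
move=> Rm xy zy; split=> -[cw [/unzip1_cat3[cu [a [b [d [cv [-> <- <-]]]]]]]].
  have [ab|ab] := boolP ((a == b) && (a < t)); last first.
    move=> cwI <-; exists (cu ++ [:: (z, b); (x, a); (y, d)] ++ cv); split.
    - by rewrite /unzip1 !map_cat.
    - move=> e et; have := cwI e et; rewrite !colour_class_cat.
      congr (sorted _ (_ ++ _ ++ _)); rewrite /colour_class /=.
      by have [ae|_] := eqVneq a e; have [be|_] := eqVneq b e => //=; lia.
    - by rewrite !count_cat /=; lia.
  case/andP: ab => /eqP <- {b} at_ cwI <-.
  have Ca := cwI a at_; rewrite !colour_class_cat /colour_class /= eqxx /= in Ca.
  have da : d != a.
    apply: contraTN Ca => /eqP->; rewrite eqxx /= sorted_cat_cons /=.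
    by rewrite (negPf zy) !(andbF, andFb).
  rewrite (negPf da) /= sorted_cat_cons /= -/(colour_class _ _) in Ca.
  case/and3P: Ca => Cax xz Caz.
  have [dt|dt] := ltnP d t.
    have := cwI d dt; rewrite !colour_class_cat /colour_class /= eqxx.
    rewrite eq_sym (negPf da) /= sorted_cat_cons /= -/(colour_class _ _).
    case/andP=> Cdy Cdv.
    exists (cu ++ [:: (z, d); (x, a); (y, a)] ++ swap_colours a d cv); split.
    - by rewrite /unzip1 !map_cat -!/unzip1 swap_colours_unzip.
    - move=> e et; rewrite !colour_class_cat swap_colours_class.
      have [->|ea] := eqVneq e a.
        rewrite /colour_class /= eqxx (negPf da) /= -/(colour_class _ _).
        by rewrite sorted_cat_cons Cax /= xy.
      have [->|ed] := eqVneq e d.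
        rewrite /colour_class /= eqxx eq_sym (negPf da) /= -/(colour_class _ _).
        rewrite sorted_cat_cons Caz andbT.
        by apply: sorted_rcons_weaken Cdy => l ly; apply: mixed_ltr ly zy.
      have := cwI e et; rewrite !colour_class_cat.
      by rewrite /colour_class /= !(eq_sym _ e) (negPf ea) (negPf ed).
    - by rewrite !count_cat swap_colours_count //=; lia.
  exists (cu ++ [:: (z, d); (x, a); (y, a)] ++ cv); split.
  - by rewrite /unzip1 !map_cat.
  - move=> e et; have := cwI e et; rewrite !colour_class_cat /colour_class /=.
    have [<-|ea] := eqVneq a e.
      rewrite (negPf da) /= !sorted_cat_cons Cax /= xy => /andP[_] zv.
      by apply: path_weaken zv => l zl; apply: mixed_ltl zl zy.
    by rewrite (_ : d == e = false) //; lia.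
  - by rewrite !count_cat /=; lia.
move=> cwI <-; exists (cu ++ [:: (x, b); (z, a); (y, d)] ++ cv); split.
- by rewrite /unzip1 !map_cat.
- move=> e et; have := cwI e et; rewrite !colour_class_cat /colour_class /=.
  have [ae|_] := eqVneq a e; have [be|_] := eqVneq b e => //=.
  rewrite sorted_cat_cons /= => /and3P[_ zx].
  by case: Rm => /(_ _ _ _ zx xy); rewrite (negPf zy).
- by rewrite !count_cat /=; lia.
Qed.

(** The same repair as for the first move: when x and z share a colour, y is
followed by z, and x by the tail of the subsequence of y. *)
Lemma colourable_Knuth2 R t m u v x y z : mixed_order R ->
    ~~ R y x -> R y z ->
  colourable R t m (u ++ [:: y; x; z] ++ v) <->
  colourable R t m (u ++ [:: y; z; x] ++ v).
Proof.
move=> Rm yx yz; split=> -[cw [/unzip1_cat3[cu [d [a [b [cv [-> <- <-]]]]]]]].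
  have [ab|ab] := boolP ((a == b) && (a < t)); last first.
    move=> cwI <-; exists (cu ++ [:: (y, d); (z, b); (x, a)] ++ cv); split.
    - by rewrite /unzip1 !map_cat.
    - move=> e et; have := cwI e et; rewrite !colour_class_cat.
      congr (sorted _ (_ ++ _ ++ _)); rewrite /colour_class /=.
      by have [ae|_] := eqVneq a e; have [be|_] := eqVneq b e => //=; lia.
    - by rewrite !count_cat /=; lia.
  case/andP: ab => /eqP <- {b} at_ cwI <-.
  have Ca := cwI a at_; rewrite !colour_class_cat /colour_class /= eqxx /= in Ca.
  have da : d != a.
    apply: contraTN Ca => /eqP->; rewrite eqxx /= sorted_cat_cons /=.
    by rewrite (negPf yx) !(andbF, andFb).
  rewrite (negPf da) /= sorted_cat_cons /= -/(colour_class _ _) in Ca.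
  case/and3P: Ca => Cax xz Caz.
  have [dt|dt] := ltnP d t.
    have := cwI d dt; rewrite !colour_class_cat /colour_class /= eqxx.
    rewrite eq_sym (negPf da) /= sorted_cat_cons /= -/(colour_class _ _).
    case/andP=> Cdy Cdv.
    exists (cu ++ [:: (y, d); (z, d); (x, a)] ++ swap_colours a d cv); split.
    - by rewrite /unzip1 !map_cat -!/unzip1 swap_colours_unzip.
    - move=> e et; rewrite !colour_class_cat swap_colours_class.
      have [->|ea] := eqVneq e a.
        rewrite /colour_class /= eqxx (negPf da) /= -/(colour_class _ _).
        rewrite sorted_cat_cons Cax /=.
        by apply: path_weaken Cdv => l yl; apply: mixed_ltl yl yx.
      have [->|ed] := eqVneq e d.
        rewrite /colour_class /= eqxx eq_sym (negPf da) /= -/(colour_class _ _).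
        by rewrite sorted_cat_cons Cdy /= yz.
      have := cwI e et; rewrite !colour_class_cat.
      by rewrite /colour_class /= !(eq_sym _ e) (negPf ea) (negPf ed).
    - by rewrite !count_cat swap_colours_count //=; lia.
  exists (cu ++ [:: (y, a); (z, a); (x, d)] ++ cv); split.
  - by rewrite /unzip1 !map_cat.
  - move=> e et; have := cwI e et; rewrite !colour_class_cat /colour_class /=.
    have [<-|ea] := eqVneq a e.
      rewrite (negPf da) /= !sorted_cat_cons /= yz Caz Cax !andbT => _.
      by apply: sorted_rcons_weaken Cax => l lx; apply: mixed_ltr lx yx.
    by rewrite (_ : d == e = false) //; lia.
  - by rewrite !count_cat /=; lia.
move=> cwI <-; exists (cu ++ [:: (y, d); (x, b); (z, a)] ++ cv); split.
- by rewrite /unzip1 !map_cat.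
- move=> e et; have := cwI e et; rewrite !colour_class_cat /colour_class /=.
  have [ae|_] := eqVneq a e; have [be|_] := eqVneq b e => //=.
  have [de|_] := eqVneq d e => /=; rewrite !sorted_cat_cons /=.
    by case/and4P=> _ _ zx; case: Rm => /(_ _ _ _ yz zx); rewrite (negPf yx).
  by case/and3P=> _ zx; case: Rm => /(_ _ _ _ yz zx); rewrite (negPf yx).
- by rewrite !count_cat /=; lia.
Qed.

Lemma colourable_knuth R t m w1 w2 : mixed_order R ->
  knuth R w1 w2 -> colourable R t m w1 <-> colourable R t m w2.
Proof.
move=> Rm; elim=> [u v x y z xy zy|u v x y z yx yz|w|w3 w4 _|w3 w4 w5 _ IH1 _ IH2].
- exact: colourable_Knuth1.
- exact: colourable_Knuth2.
- by [].
- by move=> ->.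
- by rewrite IH1.
Qed.

(** * Exchanging a letter between two adjacent rows *)

(** When the dot moves down from row i, the letter a below it leaves row i + 1
and enters row i: the word u1 a u2 v1 v2 becomes u1 u2 v1 a v2, where u1 and v1
are to the left of the column of the dot and u2 and v2 to its right. The columns
on the left and on the right are peeled off one at a time. *)
Section TwoRows.

Variables (R : rel nat) (Rm : mixed_order R) (lower upper : nat -> option nat).

Lemma knuth_pull_left y x s :
  path R y s -> ~~ R y x -> knuth R (y :: rcons s x) (y :: x :: s).
Proof.
elim: s y => [|z s IH] y /=; first by move=> _ _; apply: KnuthRefl.
case/andP=> yz zs yx; apply: (@KnuthTrans _ _ [:: y, z, x & s]).
  apply: (knuth_catl [:: y]); apply: IH => //.
  by apply: contra yx; apply: Rm.1.
by apply: KnuthSym; apply: (@Knuth2 R [::] s).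
Qed.

(** The induction takes away the first column u, v on the right and continues
with v in the role of a: v moves left to stand after u, then a exchanges with u,
and once the remaining columns are done, a moves right past the rest of the
lower row. *)
Lemma knuth_right_columns s a :
    path R a (pmap lower s) -> path R a (pmap upper s) ->
    sorted (fun j k => lower k ==> lower j) s ->
    {in s, forall j u, lower j = Some u -> exists2 v, upper j = Some v & ~~ R u v} ->
  knuth R (a :: pmap lower s ++ pmap upper s) (pmap lower s ++ a :: pmap upper s).
Proof.
elim: s a => [|j s IH] a //=; first by move=> *; apply: KnuthRefl.
case lj: (lower j) => [u|]; last first.
  move=> _ _ js _; suff -> : pmap lower s = [::] by apply: KnuthRefl.
  elim: {IH} s j lj js => //= k s IH j lj; rewrite lj implybF => /andP[].
  by case lk: (lower k) => // _; apply: IH.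
move=> /= + + js al; have [v vj uv] := al j (mem_head _ _) _ lj.
rewrite vj /= => /andP[au us] /andP[av vs].
have {}IH : knuth R (v :: pmap lower s ++ pmap upper s)
                    (pmap lower s ++ v :: pmap upper s).
  apply: IH => //; last by move=> k ks; apply: al; rewrite inE ks orbT.
    by apply: path_weaken us => l ul; apply: mixed_ltl ul uv.
  exact: path_sorted js.
have ua : ~~ R u a by apply: contra uv => ua; apply: Rm.1 ua av.
apply: (@KnuthTrans _ _ [:: a, u, v & pmap lower s ++ pmap upper s]).
  apply: (knuth_catl [:: a]); rewrite -cat_rcons -!cat_cons.
  by apply/knuth_catr/knuth_pull_left.
apply: (@KnuthTrans _ _ [:: u, a, v & pmap lower s ++ pmap upper s]).
  exact: (@Knuth1 R [::]).
apply: (KnuthTrans (knuth_catl [:: u; a] IH)) => /=.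
rewrite -(cat_rcons a) -!cat_cons.
by apply/knuth_catr/KnuthSym/knuth_pull_left.
Qed.

(** A column u, v on the left can be pulled to the front of both words, since v
is smaller than all that stands between them. *)
Lemma knuth_left_columns s M M' Y Y' :
    sorted R (pmap lower s ++ M) -> sorted R (pmap lower s ++ M') ->
    {in s, forall j v, upper j = Some v -> exists2 u, lower j = Some u & ~~ R u v} ->
    knuth R (M ++ Y) (M' ++ Y') ->
  knuth R (pmap lower s ++ M ++ pmap upper s ++ Y)
          (pmap lower s ++ M' ++ pmap upper s ++ Y').
Proof.
move=> + + + K; elim: s => [|j s IH] //= sM sM' al.
have {}IH : knuth R (pmap lower s ++ M ++ pmap upper s ++ Y)
                    (pmap lower s ++ M' ++ pmap upper s ++ Y').
  apply: IH => [||k ks].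
  - by move: sM; case: (lower j) => //= u; apply: path_sorted.
  - by move: sM'; case: (lower j) => //= u; apply: path_sorted.
  - by apply: al; rewrite inE ks orbT.
case vj: (upper j) => [v|] /=; last first.
  by case: (lower j) => //= u; apply: (knuth_catl [:: u]).
have [u uj uv] := al j (mem_head _ _) _ vj; rewrite uj /= in sM sM' *.
have pull N Z : path R u (pmap lower s ++ N) ->
    knuth R (u :: pmap lower s ++ N ++ v :: pmap upper s ++ Z)
            (u :: v :: pmap lower s ++ N ++ pmap upper s ++ Z).
  move=> uN; have := knuth_catr (pmap upper s ++ Z) (knuth_pull_left uN uv).
  by rewrite /= cat_rcons -!catA.
apply: (KnuthTrans (pull _ _ sM)); apply: KnuthTrans (KnuthSym (pull _ _ sM')).
exact: (knuth_catl [:: u; v]).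
Qed.

End TwoRows.

(** * Slides *)

Definition board := cell -> option nat.

Definition swap (p : cell) : cell := (p.2, p.1).

Definition transpose (F : board) : board := fun p => F (swap p).

Definition row_ordered (R : rel nat) (F : board) :=
  forall i j j' a b, j < j' -> F (i, j) = Some a -> F (i, j') = Some b -> R a b.

Definition tableau (R : rel nat) (F : board) :=
  row_ordered R F /\ row_ordered (dual_order R) (transpose F).

Lemma tableau_col R F i i' j a b : tableau R F -> i < i' ->
  F (i, j) = Some a -> F (i', j) = Some b -> ~~ R b a.
Proof. by move=> [_ col] ii' Fa Fb; apply: (col j i i'). Qed.

Lemma tableau_transpose R F :
  tableau R F -> tableau (dual_order R) (transpose F).
Proof.
case=> rF cF; split=> // i j j' a b jj' Fa Fb.
by rewrite /dual_order negbK; apply: rF Fa Fb.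
Qed.

(** With [R] equal to [orient_le delta] this is the rule of delta-jeu-de-taquin:
for equal neighbours the choice depends on whether [R a a] holds. *)
Definition target (R : rel nat) (F : board) (p : cell) : option cell :=
  match F (below p), F (right_of p) with
  | Some a, Some b => if R a b then Some (below p) else Some (right_of p)
  | Some _, None => Some (below p)
  | None, Some _ => Some (right_of p)
  | None, None => None
  end.

Definition swap_entries (F : board) (p q : cell) : board :=
  fun x => if x == q then F p else if x == p then F q else F x.

(** Boards are compared pointwise, so that slides of lists and transposed slides
give instances of this relation without functional extensionality. *)
Inductive slides (R : rel nat) : board -> cell -> board -> cell -> Prop :=
| SlidesDone F F' p : target R F p = None -> F' =1 F -> slides R F p F' p
| SlidesStep F G F' p q e :
    target R F p = Some q -> G =1 swap_entries F p q ->
    slides R G q F' e -> slides R F p F' e.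

Definition cell_le (p q : cell) := (p.1 <= q.1) && (p.2 <= q.2).

Definition convex (A : pred cell) :=
  forall p q s, A p -> A s -> cell_le p q -> cell_le q s -> A q.

(** A slide in progress: [A] is the skew diagram formed by the undotted cells and
the position [p] of the moving dot, and stays the same during the slide. *)
Record hole (A : pred cell) (F : board) (p : cell) : Prop := Hole {
  hole_in : A p;
  hole_convex : convex A;
  hole_support : forall q, isSome (F q) = A q && (q != p)
}.

Lemma swapK : involutive swap. Proof. by case. Qed.

Lemma swap_eq p q : (swap p == q) = (p == swap q).
Proof. exact: (inv_eq swapK). Qed.

Lemma hole_None A F p : hole A F p -> F p = None.
Proof. by case=> _ _ /(_ p); rewrite eqxx andbF; case: (F p). Qed.

Lemma hole_transpose A F p : hole A F p ->
  hole (fun q => A (swap q)) (transpose F) (swap p).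
Proof.
case=> Ap cA Fs; split; first by rewrite swapK.
  move=> x y z Ax Az /andP[xy1 xy2] /andP[yz1 yz2].
  by apply: cA Ax Az _ _; rewrite /cell_le /= ?xy1 ?xy2 ?yz1 ?yz2.
by move=> q; rewrite /transpose Fs swap_eq.
Qed.

Lemma target_transpose R F p :
  target (dual_order R) (transpose F) (swap p) = omap swap (target R F p).
Proof.
rewrite /target /transpose /below /right_of /dual_order /=.
case: (F (p.1.+1, p.2)) => [a|]; case: (F (p.1, p.2.+1)) => [b|] //=.
by case: (R a b).
Qed.

Lemma slides_transpose R F p F' e : slides R F p F' e ->
  slides (dual_order R) (transpose F) (swap p) (transpose F') (swap e).
Proof.
elim=> {F p F' e} [F F' p tF FF'|F G F' p q e tF FG _ IH].
  by apply: SlidesDone => [|x]; rewrite ?target_transpose ?tF // /transpose FF'.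
apply: SlidesStep IH; first by rewrite target_transpose tF.
by move=> x; rewrite /swap_entries /transpose FG /swap_entries !swapK !swap_eq.
Qed.

Lemma target_next R F p q : target R F p = Some q ->
  exists2 a, F q = Some a & q = below p \/ q = right_of p.
Proof.
rewrite /target; case Fb: (F (below p)) => [a|]; case Fr: (F (right_of p)) => [b|] //.
- by case: ifP => _ [<-]; [exists a|exists b]; auto.
- by move=> [<-]; exists a; auto.
- by move=> [<-]; exists b; auto.
Qed.

Lemma target_None R F p :
  target R F p = None -> F (below p) = None /\ F (right_of p) = None.
Proof.
rewrite /target; case: (F (below p)) => [a|]; case: (F (right_of p)) => [b|] //.
by case: ifP.
Qed.

Lemma hole_next R A F G p q : hole A F p -> target R F p = Some q ->
  G =1 swap_entries F p q -> hole A G q.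
Proof.
case=> Ap cA Fs tF FG; have [a Fq pq] := target_next tF.
have := Fs q; rewrite Fq => /esym/andP[Aq qp].
split=> // x; rewrite FG /swap_entries.
have [->|xq] := eqVneq x q; first by rewrite Fs eqxx !andbF.
by have [->|xp] := eqVneq x p; rewrite ?Fq ?Ap // Fs xp.
Qed.

Lemma row_ordered_right R F G p a :
  row_ordered R F -> F (right_of p) = Some a ->
  F p = None -> G =1 swap_entries F p (right_of p) -> row_ordered R G.
Proof.
case: p => i0 j0 rF Fa Fp FG i j j' x y jj'; rewrite !FG /swap_entries Fp Fa /right_of /=.
rewrite !xpair_eqE.
have [->|ii] := eqVneq i i0 => /=; last exact: rF.
case: (eqVneq j j0.+1) => [_|j1] //.
case: (eqVneq j' j0.+1) => [_|j'1] //.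
case: (eqVneq j j0) => [jE|j2]; case: (eqVneq j' j0) => [j'E|j'2] //=.
- by lia.
- by move=> [<-] Fy; apply: (rF i0 j0.+1 j') Fa Fy; lia.
- by move=> Fx [<-]; apply: (rF i0 j j0.+1) Fx Fa; lia.
- exact: rF.
Qed.

(** The letter a that moves up into row i0 must follow the letter x on its left;
as x stands above a letter u, which precedes a in the lower row, this is
transitivity through u. *)
Lemma row_ordered_below R A F G p : mixed_order R -> tableau R F -> hole A F p ->
  target R F p = Some (below p) -> G =1 swap_entries F p (below p) -> row_ordered R G.
Proof.
case: p => i0 j0 Rm tF hF tg FG; have [rF cF] := tF.
have [Ap cA Fs] := hF; have [a Fa _] := target_next tg.
have Ab : A (i0.+1, j0) by have := Fs (below (i0, j0)); rewrite Fa => /esym/andP[].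
have Fp := hole_None hF.
move=> i j j' x y jj'; rewrite !FG /swap_entries Fp Fa /below /= !xpair_eqE.
have [ij|/negbTE ij] := boolP ((i == i0.+1) && (j == j0)) => //.
have [ij'|/negbTE ij'] := boolP ((i == i0.+1) && (j' == j0)) => //.
have [/andP[/eqP-> /eqP jE]|/negbTE ij2] := boolP ((i == i0) && (j == j0)).
  have -> : (i0 == i0) && (j' == j0) = false by lia.
  case=> <- Fy; have [yE|yN] := eqVneq j' j0.+1.
    move: tg; rewrite /target Fa /right_of /= -yE Fy.
    by case: ifP => // _ []; rewrite /below; lia.
  have : F (i0, j0.+1).
    rewrite Fs; apply/andP; split; last by rewrite xpair_eqE; lia.
    apply: (cA (i0, j0) _ (i0, j')) => //; rewrite /cell_le /=; try lia.
    by have := Fs (i0, j'); rewrite Fy => /esym/andP[].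
  case Fz: (F (i0, j0.+1)) => [z|] // _.
  have zy : R z y by apply: rF Fz Fy; lia.
  apply: (Rm.1 z) => //; move: tg; rewrite /target Fa /right_of /= Fz.
  by case: ifP => // _ []; rewrite /below; lia.
have [/andP[/eqP-> /eqP jE]|_] := boolP ((i == i0) && (j' == j0)); last exact: rF.
move=> Fx [<-].
have : F (i0.+1, j).
  rewrite Fs; apply/andP; split; last by rewrite xpair_eqE; lia.
  apply: (cA (i0, j) _ (i0.+1, j0)) => //; rewrite /cell_le /=; try lia.
  by have := Fs (i0, j); rewrite Fx => /esym/andP[].
case Fu: (F (i0.+1, j)) => [u|] // _.
have ux : ~~ R u x by apply: tableau_col tF _ Fx Fu.
by apply: mixed_ltl ux => //; apply: (rF i0.+1 j j0) Fu Fa; lia.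
Qed.

Lemma tableau_next R A F G p q : mixed_order R -> tableau R F -> hole A F p ->
  target R F p = Some q -> G =1 swap_entries F p q -> tableau R G.
Proof.
move=> Rm tF hF tg FG.
have Fp := hole_None hF.
have TG : transpose G =1 swap_entries (transpose F) (swap p) (swap q).
  by move=> x; rewrite /swap_entries /transpose FG /swap_entries !swapK !swap_eq.
have Dm := mixed_dual Rm.
have tT := tableau_transpose tF.
have tgT : target (dual_order R) (transpose F) (swap p) = Some (swap q).
  by rewrite target_transpose tg.
have [a Fq [] qE] := target_next tg; rewrite {q}qE in tg FG TG tgT Fq; split.
- exact: row_ordered_below tF hF tg FG.
- apply: row_ordered_right TG; first exact: tF.2; last by rewrite /transpose swapK.
  by rewrite /transpose /= Fq.
- by apply: row_ordered_right FG; [apply: tF.1|apply: Fq|].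
- by apply: row_ordered_below (hole_transpose hF) tgT TG.
Qed.

(** * Reading words *)

Definition row_word (c : nat) (F : board) (i : nat) : seq nat :=
  pmap (fun j => F (i, j)) (iota 0 c).

Definition reading_word (r c : nat) (F : board) : seq nat :=
  flatten [seq row_word c F i | i <- rev (iota 0 r)].

Lemma eq_row_word c F G i : (forall j, F (i, j) = G (i, j)) ->
  row_word c F i = row_word c G i.
Proof. by move=> FG; apply: eq_pmap. Qed.

Lemma eq_reading_word r c F G : F =1 G -> reading_word r c F = reading_word r c G.
Proof.
move=> FG; congr flatten; apply: eq_map => i; exact: eq_row_word.
Qed.

Lemma sorted_row (R : rel nat) F i s : mixed_order R -> row_ordered R F ->
  sorted ltn s -> sorted R (pmap (fun j => F (i, j)) s).
Proof.
move=> Rm rF; rewrite (sorted_pairwise ltn_trans) (sorted_pairwise Rm.1).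
elim: s => //= j s IH /andP[js /IH{}IH]; case Fj: (F (i, j)) => [a|] //=.
rewrite IH andbT all_pmap; apply/allP => k ks /=.
case Fk: (F (i, k)) => [b|] //=; apply: rF Fj Fk; exact: (allP js).
Qed.

Lemma iota_split j c : j < c -> iota 0 c = iota 0 j ++ j :: iota j.+1 (c - j.+1).
Proof. by move=> jc; rewrite -{1}(subnKC jc) addSnnS iotaD. Qed.

Lemma iota_split2 j c : j.+1 < c ->
  iota 0 c = iota 0 j ++ [:: j, j.+1 & iota j.+2 (c - j.+2)].
Proof.
by move=> jc; rewrite (iota_split (ltnW jc)); have -> : c - j.+1 = (c - j.+2).+1 by lia.
Qed.

Lemma reading_word_split r c F i : i.+1 < r -> exists X Z,
  forall G, (forall x, x.1 != i -> x.1 != i.+1 -> G x = F x) ->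
  reading_word r c G = X ++ (row_word c G i.+1 ++ row_word c G i) ++ Z.
Proof.
move=> ir; exists (flatten [seq row_word c F k | k <- rev (iota i.+2 (r - i.+2))]).
exists (flatten [seq row_word c F k | k <- rev (iota 0 i)]) => G GF.
rewrite /reading_word (iota_split2 ir) rev_cat !rev_cons -!cats1 -!catA /=.
rewrite !map_cat !flatten_cat /=.
congr (_ ++ _ ++ _ ++ _); congr flatten; apply/eq_in_map => k;
  rewrite mem_rev mem_iota => ki; apply: eq_row_word => j; apply: GF => /=; lia.
Qed.

Lemma word_step_right r c F G i j a : j.+1 < c ->
  F (i, j) = None -> F (i, j.+1) = Some a ->
  G =1 swap_entries F (i, j) (i, j.+1) ->
  reading_word r c G = reading_word r c F.
Proof.
move=> jc Fp Fa FG; congr flatten; apply: eq_map => k.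
have [->|ki] := eqVneq k i; last first.
  by apply: eq_row_word => l; rewrite FG /swap_entries !xpair_eqE (negPf ki).
have E l : l != j -> l != j.+1 -> G (i, l) = F (i, l).
  by move=> lj lj1; rewrite FG /swap_entries !xpair_eqE eqxx /= (negPf lj) (negPf lj1).
rewrite /row_word (iota_split2 jc) !pmap_cat /= !FG /swap_entries !xpair_eqE !eqxx /=.
rewrite Fp Fa (_ : j == j.+1 = false) /=; last by lia.
congr (_ ++ _ :: _); apply: eq_in_pmap => l; rewrite mem_iota => lj; apply: E; lia.
Qed.

Lemma word_step_below R A r c F G i j a : mixed_order R ->
    hole A F (i, j) -> tableau R F ->
    i.+1 < r -> j < c -> F (i.+1, j) = Some a ->
    target R F (i, j) = Some (i.+1, j) ->
    G =1 swap_entries F (i, j) (i.+1, j) ->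
  knuth R (reading_word r c F) (reading_word r c G).
Proof.
move=> Rm hF tF ir jc Fa tg FG; have [Ap cA Fs] := hF; have [rF cF] := tF.
have Fp := hole_None hF.
have inA x b : F x = Some b -> A x by move=> Fx; have := Fs x; rewrite Fx => /esym/andP[].
have Aq := inA _ _ Fa.
have inF k l : A (k, l) -> (k, l) != (i, j) -> F (k, l).
  by move=> Akl kl; rewrite Fs Akl.
have [rG _] := tableau_next Rm tF hF tg FG.
have [X [Z XZ]] := reading_word_split c F ir.
rewrite (XZ F) // (XZ G); last first.
  move=> [k l] /= ki ki1; rewrite FG /swap_entries !xpair_eqE.
  by rewrite (negPf ki) (negPf ki1).
apply: knuth_cat.
set s := iota 0 j; set t := iota j.+1 (c - j.+1).
have E k l : l != j -> G (k, l) = F (k, l).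
  by move=> lj; rewrite FG /swap_entries !xpair_eqE (negPf lj) !andbF.
have Es k : pmap (fun l => G (k, l)) s = pmap (fun l => F (k, l)) s.
  by apply: eq_in_pmap => l; rewrite mem_iota => lj; apply: E; lia.
have Et k : pmap (fun l => G (k, l)) t = pmap (fun l => F (k, l)) t.
  by apply: eq_in_pmap => l; rewrite mem_iota => lj; apply: E; lia.
have Gp : G (i, j) = Some a.
  by rewrite FG /swap_entries !xpair_eqE !eqxx (ltn_eqF (ltnSn i)).
have Gq : G (i.+1, j) = None by rewrite FG /swap_entries eqxx.
have sF := sorted_row i.+1 Rm rF (iota_ltn_sorted 0 c).
have sG := sorted_row i Rm rG (iota_ltn_sorted 0 c).
have sG1 := sorted_row i.+1 Rm rG (iota_ltn_sorted 0 c).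
move: sF sG sG1; rewrite /row_word (iota_split jc) -/s -/t !pmap_cat /=.
rewrite !Es !Et Fa Fp Gp Gq /= => sF sG sG1.
set u2 := pmap (fun l => F (i.+1, l)) t in sF sG1 *.
rewrite -!catA; apply: (@knuth_left_columns R Rm (fun l => F (i.+1, l))
  (fun l => F (i, l)) s (a :: u2) u2) => //.
  move=> l; rewrite mem_iota => lj v Fv.
  have : F (i.+1, l).
    apply: inF; last by rewrite xpair_eqE; lia.
    by apply: (cA (i, l) _ (i.+1, j)) => //; rewrite ?(inA _ _ Fv) // /cell_le /=; lia.
  case Fu: (F (i.+1, l)) => [u|] // _; exists u => //.
  exact: tableau_col tF _ Fv Fu.
have ps k x y : sorted R (x ++ k :: y) -> path R k y.
  by rewrite sorted_cat_cons => /andP[].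
rewrite cat_cons; apply: knuth_right_columns => //; try exact: ps sF; try exact: ps sG.
- apply: (@sub_in_sorted _ (fun l => j < l) ltn); last exact: iota_ltn_sorted.
    move=> l m jl jm lm; rewrite /in_mem /= in jl jm.
    apply/implyP => Fm; apply: inF; last by rewrite xpair_eqE; lia.
    apply: (cA (i.+1, j) _ (i.+1, m)) => //; rewrite /cell_le /=; try lia.
    by case Fm': (F (i.+1, m)) Fm => [b|] // _; apply: inA Fm'.
  by apply/allP => l; rewrite mem_iota /in_mem /=; lia.
- move=> l; rewrite mem_iota => jl u Fu.
  have : F (i, l).
    apply: inF; last by rewrite xpair_eqE; lia.
    by apply: (cA (i, j) _ (i.+1, l)) => //; rewrite ?(inA _ _ Fu) // /cell_le /=; lia.
  case Fv: (F (i, l)) => [v|] // _; exists v => //.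
  exact: tableau_col tF _ Fv Fu.
Qed.

(** * Paths of slides *)

Lemma below_neq p : below p != p.
Proof. by apply/eqP => /(congr1 fst) /=; lia. Qed.

Lemma right_of_neq p : right_of p != p.
Proof. by apply/eqP => /(congr1 snd) /=; lia. Qed.

Lemma eq_hole A F G p : F =1 G -> hole A F p -> hole A G p.
Proof. by move=> FG [Ap cA Fs]; split=> // q; rewrite -FG. Qed.

Lemma eq_tableau R F G : F =1 G -> tableau R F -> tableau R G.
Proof.
move=> FG [rF cF]; split=> i j j' a b jj'; rewrite /transpose -!FG; first exact: rF.
exact: cF.
Qed.

Definition in_rect (r c : nat) (p : cell) := (p.1 < r) && (p.2 < c).

Lemma slides_invariant R (A : pred cell) r c F p F' e : mixed_order R ->
    (forall x, A x -> in_rect r c x) ->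
    slides R F p F' e -> hole A F p -> tableau R F ->
  [/\ hole A F' e, tableau R F',
      knuth R (reading_word r c F) (reading_word r c F'),
      ~~ A (below e) & ~~ A (right_of e)].
Proof.
move=> Rm Arc; elim=> {F p F' e} [F F' p tF FF'|F G F' p q e tg FG _ IH] hF tF'.
  have FF := fsym FF'; have [Fb Fr] := target_None tF; split.
  - exact: eq_hole hF.
  - exact: eq_tableau tF'.
  - by rewrite (eq_reading_word r c FF'); apply: KnuthRefl.
  - by have := hole_support hF (below p); rewrite Fb below_neq andbT => <-.
  - by have := hole_support hF (right_of p); rewrite Fr right_of_neq andbT => <-.
have hG := hole_next hF tg FG.
have tG := tableau_next Rm tF' hF tg FG.
have [hF' tF2 K Nb Nr] := IH hG tG; split=> //; apply: KnuthTrans K.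
have Fp := hole_None hF.
have [a Fq pq] := target_next tg.
have := Arc _ (hole_in hG); rewrite /in_rect.
case: p hF tg FG Fp pq {IH} => i j hF tg FG Fp [] qE; rewrite {q}qE /= in tg FG hG Fq *.
  by case/andP=> ir jc; apply: word_step_below tg FG => //; eassumption.
case/andP=> ir jc; rewrite (word_step_right r jc Fp Fq FG); exact: KnuthRefl.
Qed.

Lemma slides_le R F p F' e : slides R F p F' e -> cell_le p e.
Proof.
elim=> {F p F' e} [F F' p _ _|F G F' p q e tg _ _]; rewrite /cell_le; first by lia.
by have [a _ [] ->] := target_next tg; rewrite /=; lia.
Qed.

(** The dot moves only right and down. *)
Lemma slides_outside R F p F' e x : slides R F p F' e -> ~~ cell_le p x -> F' x = F x.
Proof.
elim=> {F p F' e} [F F' p _ FF'|F G F' p q e tg FG _ IH] px; first exact: FF'.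
have [a _ qE] := target_next tg.
have qx : ~~ cell_le q x by move: px; case: qE => ->; rewrite /cell_le /=; lia.
rewrite IH // FG /swap_entries.
case: eqP qx => [->|_ _]; first by rewrite /cell_le !leqnn.
by case: eqP px => [->|//]; rewrite /cell_le !leqnn.
Qed.

Lemma slides_stay_left R i j F p F' e : slides R F p F' e ->
    i <= p.1 -> p.2 < j ->
    (forall x, i <= x.1 -> j <= x.2 -> F x = None) ->
  e.2 < j.
Proof.
elim=> {F p F' e} [//|F G F' p q e tg FG _ IH] ip pj Fx.
have [a Fq qE] := target_next tg.
have iq : i <= q.1 by case: qE => ->; rewrite /=; lia.
have qj : q.2 < j by rewrite ltnNge; apply/negP => jq; rewrite Fx in Fq.
apply: IH => // x ix jx; rewrite FG /swap_entries.
case: eqP qj => [<-|_ _]; first by rewrite ltnNge jx.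
case: eqP pj => [<-|_ _]; first by rewrite ltnNge jx.
exact: Fx.
Qed.

(** The first dot, at [p], slides and turns [F] into [F1]; then a second dot to its
left in the same row slides in a board [E] that agrees with [F1] after it in
reading direction within its row and everywhere below. The second dot leaves
each row to the left of the column where the first dot left that row. The reason
is local: if the first dot moved down in column j, replaced by a, and the second
dot comes to the cell just left of this a, then the letter below the second dot
was to the left of a in the lower row, so the second dot moves down too. *)
Lemma slides_noncrossing R (A : pred cell) F p F1 e : mixed_order R ->
    slides R F p F1 e -> hole A F p -> tableau R F ->
    (forall i j j', A (i.+1, j) -> j' < j -> A (i.+1, j')) ->
  forall E q E2 e2, slides R E q E2 e2 -> q.1 = p.1 -> q.2 < p.2 ->
    (forall x, q.1 < x.1 \/ q.1 = x.1 /\ q.2 < x.2 -> E x = F1 x) ->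
  e2.2 < e.2.
Proof.
move=> Rm + + + Al.
elim=> {F p F1 e} [F F1 p tF FF1|F G F1 p p' e tg FG sG IH] hF tF';
  move=> E q E2 e2 sE qp1 qp2 EF.
  (* The first path ends here, so nothing is left weakly below and right. *)
  apply: (slides_stay_left sE (leqnn _) qp2) => x x1 x2.
  rewrite EF; last by lia.
  rewrite FF1; case Fx: (F x) => [a|] //.
  have [Ap cA Fs] := hF; have := Fs x; rewrite Fx => /esym/andP[Ax xp].
  have px : p.1 < x.1 \/ p.2 < x.2.
    move: xp x1 x2 qp1; rewrite [x]surjective_pairing [p]surjective_pairing.
    by rewrite xpair_eqE /=; lia.
  have [Fb Fr] := target_None tF; case: px => px.
    have: F (below p); last by rewrite Fb.
    rewrite Fs below_neq andbT.
    by apply: cA Ap Ax _ _; rewrite /cell_le /=; lia.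
  have: F (right_of p); last by rewrite Fr.
  rewrite Fs right_of_neq andbT.
  by apply: cA Ap Ax _ _; rewrite /cell_le /=; lia.
have hG := hole_next hF tg FG.
have tG := tableau_next Rm tF' hF tg FG.
have [a Fq pE] := target_next tg.
case: pE => pE; rewrite {p'}pE in tg FG sG IH hG Fq; last first.
  by apply: (IH hG tG _ _ _ _ sE) => //=; lia.
have le_e := slides_le sG; rewrite /cell_le /= in le_e.
have F1p : F1 p = Some a.
  rewrite (slides_outside sG); last by rewrite /cell_le /=; lia.
  rewrite FG /swap_entries eqxx -Fq; case: eqP => // pb.
  by move: (congr1 fst pb) => /=; lia.
have F1u j : j < p.2 -> exists2 u, F1 (p.1.+1, j) = Some u & R u a.
  move=> jp; have Aj : A (p.1.+1, j) by apply: Al (hole_in hG) jp.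
  have jp' : (p.1.+1, j) != p.
    by case: (p) jp => ? ? /=; rewrite xpair_eqE; lia.
  have : F (p.1.+1, j) by rewrite (hole_support hF) Aj.
  case Fu: (F _) => [u|] // _; exists u; last by apply: tF'.1 jp Fu Fq.
  rewrite (slides_outside sG); last by rewrite /cell_le /=; lia.
  rewrite FG /swap_entries (negPf jp') -Fu xpair_eqE eqxx /= (ltn_eqF jp).
  by [].
(* The first dot moves down: follow the second dot along the row [p.1]. *)
elim: sE qp1 qp2 EF => {E q E2 e2} [E E2 q _ _|E G' E2 q q' e2 tE EG sG' IH2] qp1 qp2 EF.
  by lia.
have [b Eq' q'E] := target_next tE.
have qq' : q <> q' by move: q'E => [] -> /(congr1 (fun x => x.1 + x.2)) /=; lia.
have G'F x : q'.1 < x.1 \/ q'.1 = x.1 /\ q'.2 < x.2 -> G' x = F1 x.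
  move=> xq; rewrite EG /swap_entries.
  case: eqP xq => [->|_ xq]; first by lia.
  case: eqP xq => [->|_ xq]; first by case: q'E => -> /=; lia.
  by apply: EF; case: q'E xq => -> /=; lia.
case: q'E => q'E; rewrite {q'}q'E in tE EG sG' IH2 Eq' qq' G'F.
  by apply: (IH hG tG _ _ _ _ sG') => //=; lia.
apply: IH2 => //=.
have [//|pq] := ltnP q.2.+1 p.2.
have pE : p = right_of q by rewrite [p]surjective_pairing; congr (_, _); lia.
have [u F1q Ru] := F1u _ qp2.
have Ep : E p = Some a by rewrite EF // pE /=; lia.
have Eb : E (below q) = Some u.
  by rewrite EF /=; [rewrite /below qp1|left].
move: tE; rewrite /target -pE Ep Eb Ru => -[] /(congr1 fst) /=; rewrite pE /=; lia.
Qed.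

(** * Slides of dotted fillings *)

Lemma jdt_targetE delta D p :
  jdt_target delta D p = target (orient_le delta) (dentry D) p.
Proof.
rewrite /jdt_target /target /orient_le.
case: (dentry D (below p)) => [a|]; case: (dentry D (right_of p)) => [b|] //.
case: (ltngtP a b) => [ab|ab|->]; case: (orient delta _) => //=;
  by rewrite ?ab ?ltnn ?leqnn ?(ltnW ab) // leqNgt ab.
Qed.

Lemma dentry_dset D p x q : dentry (dset D p x) q = if q == p then x else dentry D q.
Proof.
case: p q => i j [k l]; rewrite /dentry /dset /= nth_set_nth /= xpair_eqE.
by case: (eqVneq k i) => [->|//] /=; rewrite nth_set_nth.
Qed.

Lemma dentry_exchange D p q : dentry (exchange D p q) =1 swap_entries (dentry D) p q.
Proof. by move=> x; rewrite /exchange !dentry_dset. Qed.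

Definition rectangular (T : Type) (r c : nat) (D : seq (seq T)) :=
  size D = r /\ forall i, i < r -> size (nth [::] D i) = c.

Lemma rectangular_shape (T : Type) r c (D : seq (seq T)) :
  shape D = nseq r c <-> rectangular r c D.
Proof.
split=> [sD|[sD sDi]].
  have Dr : size D = r by rewrite -(size_map size) -/(shape D) sD size_nseq.
  by split=> // i ir; rewrite -nth_shape sD nth_nseq ir.
apply: (@eq_from_nth _ 0); rewrite size_map ?size_nseq ?sD // => i ir.
by rewrite nth_shape sDi // nth_nseq ir.
Qed.

Lemma rectangular_dset r c (D : dotted_filling) p x :
  rectangular r c D -> in_rect r c p -> rectangular r c (dset D p x).
Proof.
case: p => i j [sD sDi] /andP[/= ir jc]; split; rewrite ?size_set_nth ?sD.
  exact/maxn_idPr.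
move=> k kr; rewrite nth_set_nth /=; case: eqP => [_|_]; last exact: sDi.
by rewrite size_set_nth sDi //; apply/maxn_idPr.
Qed.

Lemma dentry_rect r c (D : dotted_filling) p a :
  rectangular r c D -> dentry D p = Some a -> in_rect r c p.
Proof.
case=> sD sDi; rewrite /dentry /in_rect => Dp.
have p1 : p.1 < r.
  by rewrite ltnNge; apply/negP => rp; rewrite (nth_default [::]) ?sD // nth_nil in Dp.
rewrite p1 ltnNge; apply/negP => cp; rewrite nth_default // in Dp.
by rewrite sDi.
Qed.

(** Each step increases the sum of the coordinates of the dot, which remains
below r + c. *)
Lemma slides_iter delta r c k D p : rectangular r c D -> in_rect r c p ->
  r + c <= p.1 + p.2 + k -> exists e,
  let D' := (iter k (jdt_step delta) (D, p)).1 in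
  rectangular r c D' /\ slides (orient_le delta) (dentry D) p (dentry D') e.
Proof.
elim: k D p => [|k IH] D p Drc prc; first by move: prc => /andP[]; lia.
move=> rck; rewrite iterSr {2}/jdt_step /= jdt_targetE.
case tg: (target _ _ _) => [q|]; last first.
  exists p; rewrite iter_fix; last by rewrite /jdt_step /= jdt_targetE tg.
  by split=> //; apply: SlidesDone.
have [a Dq qE] := target_next tg.
have qrc := dentry_rect Drc Dq.
have Erc : rectangular r c (exchange D p q).
  by rewrite /exchange; do 2 apply: rectangular_dset => //.
have [|e [D'rc sD']] := IH _ q Erc qrc; first by case: qE => -> /=; lia.
by exists e; split=> //; apply: SlidesStep sD' => //; apply: dentry_exchange.
Qed.

Lemma size_flatten_rect (T : Type) r c (D : seq (seq T)) :
  rectangular r c D -> size (flatten D) = r * c.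
Proof. by move/rectangular_shape => sD; rewrite size_flatten sD sumn_nseq mulnC. Qed.

Lemma slide_slides delta r c D p : rectangular r c D -> in_rect r c p ->
  exists e, rectangular r c (slide delta D p) /\
            slides (orient_le delta) (dentry D) p (dentry (slide delta D p)) e.
Proof.
move=> Drc prc; apply: slides_iter => //.
rewrite (size_flatten_rect Drc) Drc.1; move: prc => /andP[]; nia.
Qed.

(** * Sliding a line of dots *)

Definition coord (o : orientation) (p : cell) := if o is Hor then p.2 else p.1.

Definition depth (o : orientation) (p : cell) := if o is Hor then p.1 else p.2.

Definition on_line (o : orientation) (j : nat) : cell :=
  if o is Hor then (0, j) else (j, 0).

(** The cells of the dots that have not yet been slid: the first [m] cells of the
first row or column. *)
Definition dot_line (o : orientation) (m : nat) : pred cell :=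
  fun p => (depth o p == 0) && (coord o p < m).

Definition lower_set (B : pred cell) := forall x y, B y -> cell_le x y -> B x.

Lemma hole_line o m B F : lower_set B -> B (on_line o m) ->
    (forall p, isSome (F p) = B p && ~~ dot_line o m.+1 p) ->
  hole (fun p => B p && ~~ dot_line o m p) F (on_line o m).
Proof.
move=> lB Bm Fs; split.
- by rewrite Bm; case: o {Bm Fs} => /=; rewrite /dot_line /= ltnn.
- move=> p q s /andP[Bp pm] /andP[Bs sm] pq qs; rewrite (lB _ _ Bs qs) /=.
  by move: pm pq; case: o {Bm Fs sm}; rewrite /dot_line /cell_le /=; lia.
- move=> [i j]; rewrite Fs -andbA; congr (_ && _).
  by case: o {Bm Fs}; rewrite /dot_line /= xpair_eqE; lia.
Qed.

Lemma consecutive_slides R o m B F F1 F2 e1 e2 : mixed_order R ->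
    lower_set B -> tableau R F ->
    hole (fun p => B p && ~~ dot_line o m.+1 p) F (on_line o m.+1) ->
    slides R F (on_line o m.+1) F1 e1 -> slides R F1 (on_line o m) F2 e2 ->
  coord o e2 < coord o e1.
Proof.
case: o => Rm lB tF hF s1 s2.
  apply: (slides_noncrossing Rm s1 hF tF _ s2) => //= i j j'.
  move=> /andP[Bij _] jj'; rewrite (lB _ _ Bij) // /cell_le /=; lia.
have tT := tableau_transpose tF.
have := slides_noncrossing (mixed_dual Rm) (slides_transpose s1)
  (hole_transpose hF) tT _ (slides_transpose s2).
apply=> //= i j j'.
move=> /andP[Bij _] jj'; rewrite (lB _ _ Bij) // /cell_le /=; lia.
Qed.

(** The state of a promotion when [m] dots remain: [B] is the Young diagram of the
cells that no slid dot has reached. The finished dots lie in different columns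
(rows, for a vertical letter), and the next dot will end strictly before all of
them; the last condition passes this on from one slide to the next. *)
Record sliding (R : rel nat) (o : orientation) (r c m : nat) (B : pred cell)
    (D0 D : dotted_filling) : Prop := Sliding {
  sliding_rect : rectangular r c D;
  sliding_sub : forall p, B p -> in_rect r c p;
  sliding_lower : lower_set B;
  sliding_dots : forall j, j < m -> B (on_line o j);
  sliding_support : forall p, isSome (dentry D p) = B p && ~~ dot_line o m p;
  sliding_tableau : tableau R (dentry D);
  sliding_word : knuth R (reading_word r c (dentry D0)) (reading_word r c (dentry D));
  sliding_ends : forall x y, in_rect r c x -> in_rect r c y ->
    ~~ B x -> ~~ B y -> coord o x = coord o y -> x = y;
  sliding_next : forall j E e, m = j.+1 -> slides R (dentry D) (on_line o j) E e ->
    forall x, in_rect r c x -> ~~ B x -> coord o e < coord o x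
}.

Lemma sliding_step delta o r c m B D0 D :
  sliding (orient_le delta) o r c m.+1 B D0 D ->
  exists B', sliding (orient_le delta) o r c m B' D0 (slide delta D (on_line o m)).
Proof.
have Rm := orient_le_mixed delta.
case=> Drc Brc lB Bd Ds tD K De Dn.
have Bm := Bd m (leqnn _).
have [e [Drc' sl]] := slide_slides delta Drc (Brc _ Bm).
have hD := hole_line lB Bm Ds.
have Arc p : B p && ~~ dot_line o m p -> in_rect r c p by case/andP=> /Brc.
have [hD' tD' K' Nb Nr] := slides_invariant Rm Arc sl hD tD.
have [/andP[Be em] _ Ds'] := hD'.
have line_lower x y : cell_le x y -> dot_line o m y -> dot_line o m x.
  by case: (o); rewrite /cell_le /dot_line /=; lia.
have Bmax y : B y -> cell_le e y -> y = e.
  move=> By ey; apply/eqP; apply: contraT => ye.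
  have ym : ~~ dot_line o m y by apply: contra em; apply: line_lower.
  have [ey1|ey1] : e.1 < y.1 \/ e.2 < y.2.
    have : ~~ ((y.1 == e.1) && (y.2 == e.2)) by rewrite -xpair_eqE -!surjective_pairing.
    by move: ey; rewrite /cell_le; lia.
  - case/negP: Nb; apply/andP; split.
      by apply: lB By _; move: ey; rewrite /cell_le /=; lia.
    by apply: contra em; apply: line_lower; rewrite /cell_le /=; lia.
  - case/negP: Nr; apply/andP; split.
      by apply: lB By _; move: ey; rewrite /cell_le /=; lia.
    by apply: contra em; apply: line_lower; rewrite /cell_le /=; lia.
have Nout x : ~~ (B x && (x != e)) -> ~~ B x \/ x = e.
  by rewrite negb_and negbK => /orP[|/eqP]; auto.
exists (fun p => B p && (p != e)); split=> //.
- by move=> p /andP[/Brc].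
- move=> x y /andP[By ye] xy; rewrite (lB _ _ By xy).
  by apply: contra ye => /eqP xe; rewrite (Bmax y) // -xe.
- move=> j jm; rewrite Bd 1?ltnW //=; apply: contra em => /eqP <-.
  by case: (o); rewrite /dot_line /= jm.
- by move=> p; rewrite Ds' andbAC.
- exact: KnuthTrans K'.
- move=> x y xrc yrc /Nout[Bx|->] /Nout[By|->] //.
  + exact: De.
  + by move=> xy; have := Dn _ _ _ erefl sl _ xrc Bx; rewrite xy ltnn.
  + by move=> xy; have := Dn _ _ _ erefl sl _ yrc By; rewrite xy ltnn.
- move=> j E e' mj sl' x xrc /Nout.
  rewrite mj in sl sl' hD Dn.
  have e'e := consecutive_slides Rm lB tD hD sl sl'.
  by case=> [Bx|->//]; apply: ltn_trans e'e (Dn _ _ _ erefl sl _ xrc Bx).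
Qed.

Lemma sliding_foldl delta o r c m B D0 D :
  sliding (orient_le delta) o r c m B D0 D ->
  exists B', sliding (orient_le delta) o r c 0 B' D0
    (foldl (slide delta) D [seq on_line o j | j <- rev (iota 0 m)]).
Proof.
elim: m B D => [|m IH] B D sD; first by exists B.
by have [B' /IH] := sliding_step sD; rewrite -addn1 iotaD rev_cat.
Qed.

(** * Promotion *)

(** The cells outside the diagram carry no letter, in agreement with the boards of
dotted fillings. *)
Definition board_of (T : filling) : board :=
  fun p => if p \in cells T then Some (entry T p) else None.

(** Semistandardness in a form without strips: a strip condition on a letter is
the row or column condition of [orient_le] between two equal entries. *)
Record mixed_tableau (delta : seq orientation) (r c : nat) (T : filling) : Prop :=
  MixedTableau {
    mixed_rect : rectangular r c T;
    mixed_range : forall p, p \in cells T -> 0 < entry T p <= size delta;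
    mixed_ordered : tableau (orient_le delta) (board_of T)
  }.

Lemma mem_cells T p :
  p \in cells T = (p.1 < size T) && (p.2 < size (nth [::] T p.1)).
Proof.
apply/allpairsPdep/andP => [[i [j [iT jT ->]]] /=|[p1 p2]].
  by move: iT jT; rewrite !mem_iota.
by exists p.1, p.2; rewrite !mem_iota -surjective_pairing.
Qed.

Lemma mem_cells_rect r c T p : rectangular r c T -> p \in cells T = in_rect r c p.
Proof.
case=> sT sTi; rewrite mem_cells /in_rect sT.
by have [p1|//] := ltnP; rewrite sTi.
Qed.

Lemma entry_out T p : p \notin cells T -> entry T p = 0.
Proof.
rewrite mem_cells /entry negb_and -!leqNgt => /orP[p1|p2].
  by rewrite (nth_default [::] p1) nth_nil.
by rewrite nth_default.
Qed.

Lemma board_ofP T p a : board_of T p = Some a <-> p \in cells T /\ a = entry T p.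
Proof.
rewrite /board_of; case: ifP => _; last by split=> // -[].
by split=> [[<-]|[_ ->]].
Qed.

Lemma semistandard_mixed delta r c T :
  shape T = nseq r c -> semistandard delta T -> mixed_tableau delta r c T.
Proof.
move=> /rectangular_shape rT [_ range rows cols strips].
have cw a p : p \in cells T -> entry T p = a -> p \in cells_with T a.
  by move=> pT pa; rewrite mem_filter pa eqxx.
split=> //; split=> [i j j' a b jj'|j i i' a b ii'].
- move=> /board_ofP[p ->] /board_ofP[q ->].
  have := rows _ _ p q erefl (ltnW jj'); rewrite leq_eqVlt /orient_le.
  case/predU1P => [pq|pq]; last by case: orient => //; apply: ltnW.
  have := strips _ (range _ p); case: orient => [_|vs]; first by rewrite pq.
  by have [] := vs _ _ (cw _ _ p erefl) (cw _ _ q (esym pq)) erefl; lia.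
- rewrite /transpose /swap /= => /board_ofP[p ->] /board_ofP[q ->].
  have := cols _ _ p q erefl (ltnW ii'); rewrite leq_eqVlt /dual_order /orient_le.
  case/predU1P => [pq|pq]; last by case: orient; rewrite -?ltnNge -?leqNgt // ltnW.
  have := strips _ (range _ q); case: orient => [hs|_]; last by rewrite pq ltnn.
  by have [] := hs _ _ (cw _ _ p pq) (cw _ _ q erefl) erefl; lia.
Qed.

Lemma slide_orderE o s :
  slide_order o s = sort (fun p q => coord o q <= coord o p) s.
Proof. by case: o. Qed.

Lemma mixed_row delta r c T i j j' : mixed_tableau delta r c T ->
  j < j' -> (i, j') \in cells T -> orient_le delta (entry T (i, j)) (entry T (i, j')).
Proof.
case=> rT _ [rows _] jj' q.
have p : (i, j) \in cells T.
  by move: q; rewrite !(mem_cells_rect _ rT) /in_rect /=; lia.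
by apply: (rows i j j') => //; apply/board_ofP; split.
Qed.

Lemma mixed_col delta r c T i i' j : mixed_tableau delta r c T ->
  i < i' -> (i', j) \in cells T -> ~~ orient_le delta (entry T (i', j)) (entry T (i, j)).
Proof.
case=> rT _ [_ cols] ii' q.
have p : (i, j) \in cells T.
  by move: q; rewrite !(mem_cells_rect _ rT) /in_rect /=; lia.
by apply: (cols j i i') => //; apply/board_ofP; split.
Qed.

(** The entries 1 fill an initial segment of the first row or column: a 1
elsewhere would force an equal letter above it, or to its left, against the
strip condition. *)
Lemma ones_line delta r c T : mixed_tableau delta r c T ->
  exists m, forall p, (entry T p == 1) = dot_line (orient delta 1) m p.
Proof.
move=> mT; have [rT range _] := mT; set o := orient delta 1.
have inT p : entry T p == 1 -> p \in cells T.
  by apply: contraTT => /entry_out ->.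
have ge1 p : p \in cells T -> 0 < entry T p by move=> /range /andP[].
have depth0 p : entry T p == 1 -> depth o p = 0.
  case: p => i j p1; have pT := inT _ p1; have pr := pT.
  rewrite (mem_cells_rect _ rT) /in_rect /= in pr.
  rewrite /depth; case oE: o.
    case: i p1 pT pr => //= i /eqP p1 pT pr.
    have qT : (i, j) \in cells T by rewrite (mem_cells_rect _ rT) /in_rect /=; lia.
    have := mixed_col mT (ltnSn i) pT; rewrite p1 /orient_le -/o oE /=.
    by have := ge1 _ qT; lia.
  case: j p1 pT pr => //= j /eqP p1 pT pr.
  have qT : (i, j) \in cells T by rewrite (mem_cells_rect _ rT) /in_rect /=; lia.
  have := mixed_row mT (ltnSn j) pT; rewrite p1 => /orient_le_leq le1.
  have e1 : entry T (i, j) = 1 by apply/eqP; rewrite eqn_leq le1 ge1.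
  by have := mixed_row mT (ltnSn j) pT; rewrite p1 e1 /orient_le -/o oE /=.
have exm : exists m, entry T (on_line o m) != 1.
  exists (r + c); rewrite entry_out // (mem_cells_rect _ rT) /in_rect /on_line.
  by case: (o) => /=; lia.
have [m mN mmin] := ex_minnP exm; exists m => p.
have before j : j < m -> entry T (on_line o j) == 1.
  by move=> jm; apply: contraTT jm => /mmin; rewrite -leqNgt.
have after j : m <= j -> entry T (on_line o j) != 1.
  rewrite leq_eqVlt => /predU1P[<-//|mj]; apply: contra mN => j1.
  have jT := inT _ j1; have jr := jT; rewrite (mem_cells_rect _ rT) /in_rect in jr.
  have mT' : on_line o m \in cells T.
    rewrite (mem_cells_rect _ rT) /in_rect; move: jr mj; rewrite /on_line.
    by case: (o) => /=; lia.
  have := ge1 _ mT'; have le1 : entry T (on_line o m) <= 1.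
    rewrite -(eqP j1); move: jT; rewrite /on_line; case: (o) => jT.
      exact: orient_le_leq (mixed_row mT mj jT).
    exact: orient_le_geq (mixed_col mT mj jT).
  by lia.
have pE : depth o p = 0 -> p = on_line o (coord o p).
  by case: p => i j; rewrite /depth /on_line /coord; case: (o) => /= ->.
rewrite /dot_line; apply/idP/andP => [p1|[/eqP p0 pm]]; last by rewrite (pE p0) before.
have p0 := depth0 _ p1; rewrite p0; split=> //.
by rewrite ltnNge; apply: contraL p1 => /after; rewrite -pE.
Qed.

Lemma slide_order_ones o m T :
  (forall p, (entry T p == 1) = dot_line o m p) ->
  slide_order o (cells_with T 1) = [seq on_line o j | j <- rev (iota 0 m)].
Proof.
move=> onesE; rewrite slide_orderE.
have depth0 p : p \in cells_with T 1 -> depth o p = 0.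
  by rewrite mem_filter onesE => /andP[/andP[/eqP ->]].
apply: (@sorted_eq_in _ (fun p q => coord o q <= coord o p)).
- by move=> q p s _ _ _ qp sq; apply: leq_trans sq qp.
- move=> p q; rewrite !mem_sort => /depth0 p0 /depth0 q0 /anti_leq.
  by move: p0 q0; case: p q => [i j] [k l]; case: (o) => /= -> -> ->.
- by apply: sort_sorted => p q; apply: leq_total.
- rewrite sorted_map rev_sorted; apply: sub_sorted (iota_sorted 0 m) => i j.
  by case: (o).
- rewrite perm_sort; apply: uniq_perm.
  + apply: filter_uniq; apply: allpairs_uniq_dep; rewrite ?iota_uniq //.
      by move=> i _; apply: iota_uniq.
    by move=> [i j] [k l] _ _ [/= -> ->].
  + rewrite map_inj_uniq ?rev_uniq ?iota_uniq // => i j.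
    by case: (o) => -[].
  + move=> p; rewrite mem_filter; apply/andP/mapP => [[p1 _]|[j jm ->]].
      exists (coord o p); first by move: p1; rewrite onesE mem_rev mem_iota => /andP[].
      move: p1; rewrite onesE /dot_line.
      by case: p => i j; case: (o) => /= /andP[/eqP ->].
    have j1 : entry T (on_line o j) == 1.
      rewrite onesE /dot_line; move: jm; rewrite mem_rev mem_iota add0n.
      by case: (o) => /= ->.
    by split=> //; apply: contraTT j1 => /entry_out ->.
Qed.

Lemma reading_word_pmap r c (h : nat -> option nat) F G :
  (forall p, G p = obind h (F p)) -> reading_word r c G = pmap h (reading_word r c F).
Proof.
move=> GF; rewrite /reading_word; elim: (rev _) => //= i s ->.
rewrite pmap_cat; congr (_ ++ _); rewrite /row_word; elim: (iota 0 c) => //= j t IH.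
by rewrite GF; case: (F (i, j)) => [a|//] /=; rewrite IH.
Qed.

Lemma mem_reading_word r c F a : a \in reading_word r c F <->
  exists2 p, in_rect r c p & F p = Some a.
Proof.
split.
  case/flatten_mapP => i; rewrite mem_rev mem_iota mem_pmap => ir /mapP[j].
  by rewrite mem_iota => jc Fa; exists (i, j) => //; apply/andP.
case=> -[i j] /andP[/= ir jc] Fa; apply/flatten_mapP; exists i.
  by rewrite mem_rev mem_iota.
by rewrite mem_pmap; apply/mapP; exists j; rewrite ?mem_iota.
Qed.

Definition but_one (x : nat) : option nat := if x == 1 then None else Some x.

Lemma dentry_dot_ones T p : dentry (dot_ones T) p = obind but_one (board_of T p).
Proof.
rewrite /board_of mem_cells /dentry /dot_ones /entry.
have [p1|p1] /= := ltnP p.1 (size T).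
  rewrite (nth_map [::]) //; have [p2|p2] /= := ltnP; first by rewrite (nth_map 0).
  by rewrite nth_default // size_map.
by rewrite (nth_default [::]) ?size_map // nth_nil.
Qed.

(** Lowering the letters by 1 turns the order of [delta] into that of its rotation,
as long as the letter 1, which becomes the last one, is not involved. *)
Lemma orient_le_rotate delta a b : 1 < a <= size delta -> 1 < b ->
  orient_le (rotate delta) a.-1 b.-1 = orient_le delta a b.
Proof.
case: delta => [|d delta]; first by rewrite /=; lia.
case: a => [|[|a]] // ; case: b => // b /= ad b1.
rewrite /orient_le /orient /rotate rot1_cons /= nth_rcons (_ : a < size delta); last by lia.
by case: nth; lia.
Qed.

Lemma orient_rotate_last delta : 0 < size delta ->
  orient (rotate delta) (size delta) = orient delta 1.
Proof.
by case: delta => // d delta _; rewrite /orient /rotate rot1_cons nth_rcons /= ltnn eqxx.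
Qed.

Lemma size_rotate delta : size (rotate delta) = size delta.
Proof. exact: size_rot. Qed.

(** The final dots carry the letter n. They lie outside the Young diagram of the
other letters, hence at the ends of the rows and columns, and they are in
distinct columns (or rows), which is the strip condition for n. *)
Lemma promotion_mixed delta r c T : mixed_tableau delta r c T ->
  mixed_tableau (rotate delta) r c (promotion delta T) /\
  knuth (orient_le delta)
    [seq x <- reading_word r c (board_of T) | x != 1]
    [seq x.+1 | x <- reading_word r c (board_of (promotion delta T)) & x < size delta].
Proof.
move=> mT; have [rT range oT] := mT; set n := size delta; set o := orient delta 1.
have Rm := orient_le_mixed delta.
have [m onesE] := ones_line mT.
have but_oneE p a : dentry (dot_ones T) p = Some a -> board_of T p = Some a /\ a != 1.
  rewrite dentry_dot_ones; case: (board_of T p) => //= x.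
  by rewrite /but_one; case: ifP => // x1 [<-]; rewrite x1.
have rD : rectangular r c (dot_ones T).
  case: rT => sT sTi; split; first by rewrite size_map.
  by move=> i ir; rewrite (nth_map [::]) ?sT // size_map sTi.
have sD : sliding (orient_le delta) o r c m (in_rect r c) (dot_ones T) (dot_ones T).
  split=> //.
  - by move=> x y; rewrite /in_rect /cell_le; lia.
  - move=> j jm; have : entry T (on_line o j) == 1.
      by rewrite onesE /dot_line -/o; case: (o) => /=; rewrite jm.
    rewrite -(mem_cells_rect _ rT); apply: contraTT => /entry_out -> //.
  - move=> p; rewrite dentry_dot_ones /board_of (mem_cells_rect _ rT) -onesE.
    by case: in_rect => //=; rewrite /but_one; case: ifP.
  - split=> i j j' a b jj' /but_oneE[Fa _] /but_oneE[Fb _].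
      exact: oT.1 jj' Fa Fb.
    exact: oT.2 jj' Fa Fb.
  - exact: KnuthRefl.
  - by move=> x y ->.
  - by move=> j E e _ _ x ->.
have [B] := sliding_foldl sD; rewrite -(slide_order_ones onesE) -/o.
have promE : promotion delta T = [seq [seq (odflt n.+1 x).-1 | x <- row] | row <-
  foldl (slide delta) (dot_ones T) (slide_order o (cells_with T 1))] by [].
move: promE; set D := foldl _ _ _ => promE [rD' Brc lB _ Ds tD K ends _].
have {}Ds p : isSome (dentry D p) = B p.
  by rewrite Ds /dot_line ltn0 andbF andbT.
have rP : rectangular r c (promotion delta T).
  rewrite promE; case: rD' => sD' sDi; split; first by rewrite size_map.
  by move=> i ir; rewrite (nth_map [::]) ?sD' // size_map sDi.
have PE p : board_of (promotion delta T) p =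
    if in_rect r c p then Some (odflt n.+1 (dentry D p)).-1 else None.
  rewrite /board_of (mem_cells_rect _ rP); case: ifP => // /andP[p1 p2].
  case: rD' => sD' sDi; rewrite promE /entry (nth_map [::]) ?sD' //.
  by rewrite (nth_map None) ?sDi.
have rangeD p a : dentry D p = Some a -> 1 < a <= n.
  move=> Da; have : a \in reading_word r c (dentry (dot_ones T)).
    rewrite (perm_mem (knuth_perm K)); apply/mem_reading_word; exists p => //.
    by apply: Brc; rewrite -Ds Da.
  case/mem_reading_word => q _ /but_oneE[/board_ofP[qT ->] e1].
  by have := range _ qT; lia.
have n_gt0 p : in_rect r c p -> 0 < n.
  by rewrite -(mem_cells_rect _ rT) => /range; lia.
split; last first.
  rewrite -[X in knuth _ X _](_ : reading_word r c (dentry (dot_ones T)) = _).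
    rewrite -[X in knuth _ _ X](_ : reading_word r c (dentry D) = _) //.
    rewrite (@reading_word_pmap r c (fun x => if x < n then Some x.+1 else None)
      (board_of (promotion delta T))).
      by elim: (reading_word _ _ _) => //= x s ->; case: ifP.
    move=> p; rewrite PE; case: ifP => prc /=.
      case Da: (dentry D p) => [a|] /=; last by rewrite ltnn.
      have := rangeD _ _ Da; case: ifP => an; last by lia.
      by move=> ?; congr Some; lia.
    by have := Ds p; case: (dentry D p) => // a /esym/Brc; rewrite prc.
  rewrite (reading_word_pmap r c (dentry_dot_ones T)).
  by elim: (reading_word _ _ _) => //= x s ->; rewrite /but_one; case: eqP.
split=> //.
  move=> p; rewrite (mem_cells_rect _ rP) size_rotate => prc.
  have := PE p; rewrite prc /board_of (mem_cells_rect _ rP) prc => -[->].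
  have := n_gt0 _ prc; case Da: (dentry D p) => [a|] /=; last by rewrite /n; lia.
  by have := rangeD _ _ Da; rewrite /n; lia.
have dn p a : dentry D p = Some a ->
    orient_le (rotate delta) a.-1 n /\ ~~ orient_le (rotate delta) n a.-1.
  move=> /rangeD an; have lt_an : a.-1 < n by lia.
  by rewrite /orient_le; split; case: orient; lia.
have Bd p q : in_rect r c p -> dentry D p = None -> cell_le p q -> dentry D q = None.
  move=> prc Dp pq; have := Ds q; case: (dentry D q) => // a /esym Bq.
  by have := Ds p; rewrite Dp (lB _ _ Bq pq).
have nn p q : in_rect r c p -> in_rect r c q -> dentry D p = None -> dentry D q = None ->
    coord o p = coord o q -> p = q.
  by move=> prc qrc Dp Dq; apply: ends => //; rewrite -Ds ?Dp ?Dq.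
have on : 0 < n -> orient (rotate delta) n = o by apply: orient_rotate_last.
split=> [i j j' a b jj'|j i i' a b ii']; rewrite /transpose /swap /= !PE.
- case: ifP => // prc [<-]; case: ifP => // qrc [<-].
  case Dp: (dentry D (i, j)) => [x|]; case Dq: (dentry D (i, j')) => [y|] /=.
  + have := rangeD _ _ Dp; have := rangeD _ _ Dq => /andP[y1 _] xn.
    by rewrite orient_le_rotate //; apply: tD.1 jj' Dp Dq.
  + exact: (dn _ _ Dp).1.
  + by rewrite (Bd _ (i, j') prc Dp) // in Dq; rewrite /cell_le /=; lia.
  + rewrite /orient_le (on (n_gt0 _ prc)); case oE: o => //.
    by have := nn _ _ prc qrc Dp Dq; rewrite /coord oE => /(_ erefl)[]; lia.
- case: ifP => // prc [<-]; case: ifP => // qrc [<-].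
  case Dp: (dentry D (i, j)) => [x|]; case Dq: (dentry D (i', j)) => [y|] /=.
  + have := rangeD _ _ Dp; have := rangeD _ _ Dq => yn /andP[x1 _].
    by rewrite /dual_order orient_le_rotate //; apply: tableau_col tD ii' Dp Dq.
  + exact: (dn _ _ Dp).2.
  + by rewrite (Bd _ (i', j) prc Dp) // in Dq; rewrite /cell_le /=; lia.
  + rewrite /dual_order /orient_le (on (n_gt0 _ prc)); case oE: o => //;
      last by rewrite ltnn.
    by have := nn _ _ prc qrc Dp Dq; rewrite /coord oE => /(_ erefl)[]; lia.
Qed.

(** * Iterated promotion *)

Lemma size_iter_rotate k delta : size (iter k rotate delta) = size delta.
Proof. by elim: k => //= k IH; rewrite size_rotate. Qed.

Lemma orient_le_iter_rotate k delta a b :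
  0 < a -> a + k <= size delta -> 0 < b ->
  orient_le (iter k rotate delta) a b = orient_le delta (a + k) (b + k).
Proof.
elim: k a b => [|k IH] a b a0 ak b0; first by rewrite !addn0.
rewrite iterS (orient_le_rotate (a := a.+1) (b := b.+1)) //; last first.
  by rewrite size_iter_rotate; lia.
by rewrite IH // ?addSnnS //; lia.
Qed.

Lemma promotions_add delta k l T :
  promotions delta (k + l) T = promotions (iter k rotate delta) l (promotions delta k T).
Proof. by elim: l => [|l IH]; rewrite ?addn0 // addnS /= IH addnC iterD. Qed.

Lemma mixed_word_range delta r c T : mixed_tableau delta r c T ->
  {in reading_word r c (board_of T), forall x, 0 < x <= size delta}.
Proof. by case=> _ range _ x /mem_reading_word[p _] /board_ofP[pT ->]; apply: range. Qed.

(** One promotion at the k-th stage compares all letters but 1 with all letters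
but n; restricting this equivalence to the letters at most n - k and raising the
letters by k makes it composable with the preceding stages. *)
Lemma promotions_mixed delta r c k T : mixed_tableau delta r c T -> k <= size delta ->
  mixed_tableau (iter k rotate delta) r c (promotions delta k T) /\
  knuth (orient_le delta)
    [seq x <- reading_word r c (board_of T) | k < x]
    [seq x + k | x <- reading_word r c (board_of (promotions delta k T))
               & x <= size delta - k].
Proof.
set n := size delta => mT; elim: k => [|k IH] kn.
  split=> //=; have mw := mixed_word_range mT.
  rewrite (eq_map (addn0)) map_id subn0.
  rewrite !(@eq_in_filter _ _ predT) ?filter_predT; first exact: KnuthRefl.
    by move=> x /mw /andP[_ ->].
  by move=> x /mw /andP[-> _].
have [mTk Kk] := IH (ltnW kn); rewrite [iter _ _ _]/= [promotions _ _ _]/=.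
set dk := iter k rotate delta in mTk *; set Tk := promotions delta k T in mTk Kk *.
have [mTk1 K1] := promotion_mixed mTk; split=> //.
have mw := mixed_word_range mTk.
have sk : size dk = n by rewrite size_iter_rotate.
have filt d (P : pred nat) : (forall x y z, x <= y <= z -> P x -> P z -> P y) ->
    forall w1 w2, knuth (orient_le d) w1 w2 ->
    knuth (orient_le d) (filter P w1) (filter P w2).
  move=> Pc w1 w2; apply: knuth_filter => x y z.
    by move=> /orient_le_leq xy /orient_le_geq yz; apply: Pc; rewrite xy yz.
  by move=> /orient_le_geq xy /orient_le_leq yz; apply: Pc; rewrite xy yz.
have {IH Kk} := filt _ (fun x => k.+1 < x) _ _ _ Kk.
rewrite -filter_predI (@eq_filter _ _ (fun x => k.+1 < x)); last by move=> x /=; lia.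
move=> K; apply: KnuthTrans (K _) _; first by lia.
set w := reading_word r c (board_of Tk) in mw K1 *.
set w1 := reading_word r c _ in K1 *.
have -> : [seq x <- [seq x + k | x <- w & x <= n - k] | k.+1 < x] =
    [seq x + k | x <- [seq x <- [seq x <- w | x != 1] | x <= n - k]].
  rewrite filter_map -!filter_predI; congr map.
  by apply: eq_in_filter => x /mw /andP[x0 _] /=; lia.
have -> : [seq x + k.+1 | x <- w1 & x <= n - k.+1] =
    [seq x + k | x <- [seq x <- [seq x.+1 | x <- w1 & x < size dk] | x <= n - k]].
  rewrite filter_map -map_comp -filter_predI sk (eq_map (fun x => addnS x k)).
  by congr map; apply: eq_filter => x /=; lia.
apply: knuth_map; first by apply: filt K1 => x y z; lia.
move=> x y; rewrite !mem_filter.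
move=> /and3P[xn _ /mw /andP[x0 _]] /and3P[yn _ /mw /andP[y0 _]].
by rewrite /dk orient_le_iter_rotate //; lia.
Qed.

(** * Greene's theorem for normal and antinormal shapes *)

Definition reading_cells (r c : nat) : seq cell :=
  [seq (i, j) | i <- rev (iota 0 r), j <- iota 0 c].

Definition reads_before (p q : cell) := (q.1 < p.1) || (p.1 == q.1) && (p.2 < q.2).

Lemma mem_reading_cells r c p : p \in reading_cells r c = in_rect r c p.
Proof.
apply/allpairsPdep/andP => [[i [j [ir jc ->]]]|[p1 p2]].
  by move: ir jc; rewrite mem_rev !mem_iota.
by exists p.1, p.2; rewrite mem_rev !mem_iota -surjective_pairing.
Qed.

Lemma reading_wordE r c F : reading_word r c F = pmap F (reading_cells r c).
Proof.
rewrite /reading_word /reading_cells; elim: (rev _) => //= i s ->.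
by rewrite pmap_cat /row_word; congr (_ ++ _); elim: (iota 0 c) => //= j t ->.
Qed.

Lemma reading_cells_sorted r c : pairwise reads_before (reading_cells r c).
Proof.
elim: r => // r IH; rewrite /reading_cells -addn1 iotaD rev_cat /= pairwise_cat.
apply/and3P; split=> //.
  apply/allrelP => p q /mapP[j _ ->]; rewrite (mem_reading_cells r c) /reads_before.
  by move=> /andP[/= ->].
have: pairwise ltn (iota 0 c) by rewrite -(sorted_pairwise ltn_trans) iota_ltn_sorted.
rewrite pairwise_map; apply: sub_pairwise => j k jk.
by rewrite /reads_before /= eqxx (jk : j < k) orbT.
Qed.

Lemma pairwise_mem (T : eqType) (e : rel T) s x y :
  pairwise e s -> x \in s -> y \in s -> x != y -> e x y || e y x.
Proof.
elim: s => //= z s IH /andP[/allP zs /IH{}IH]; rewrite !inE.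
case/predU1P => [->|xs]; case/predU1P => [->|ys]; rewrite ?eqxx //.
- by rewrite zs.
- by rewrite zs ?orbT.
- exact: IH.
Qed.

Lemma count_by_column (P : pred cell) c s : {in s, forall p, p.2 < c} ->
  count P s = \sum_(j < c) count (fun p => P p && (p.2 == j)) s.
Proof.
elim: s => [|p s IH] sc /=; first by rewrite big1.
rewrite big_split /= -IH; last by move=> q qs; apply: sc; rewrite inE qs orbT.
congr (_ + _); rewrite (bigD1 (Ordinal (sc p (mem_head _ _)))) //= eqxx andbT.
by rewrite big1 ?addn0 // => j; rewrite -val_eqE /= eq_sym => /negPf ->; rewrite andbF.
Qed.

Definition rank_count (Q : pred cell) (g : nat -> nat) (r c t : nat) :=
  count (fun p : cell => g p.1 < t) [seq p <- reading_cells r c | Q p].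

Section Greene.

Variables (R : rel nat) (Rm : mixed_order R) (r c : nat).
Variables (Q : pred cell) (v : cell -> nat) (g : nat -> nat).

(** [g] ranks the rows by length: it is the identity for a Young diagram and the
reversal of the rows for one that is turned upside down. *)

Let S := [seq p <- reading_cells r c | Q p].

Hypothesis rows : forall i j j' : nat, (i, j) \in S -> (i, j') \in S -> j < j' ->
  R (v (i, j)) (v (i, j')).
Hypothesis cols : forall i i' j : nat, (i, j) \in S -> (i', j) \in S -> i < i' ->
  ~~ R (v (i', j)) (v (i, j)).
Hypothesis gK : forall i, i < r -> g (g i) = i.
Hypothesis g_lt : forall i, i < r -> g i < r.
Hypothesis g_closed : forall i i' j : nat, (i, j) \in S -> i' < r -> g i' <= g i ->
  (i', j) \in S.

Let S_rect p : p \in S -> (p.1 < r) && (p.2 < c).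
Proof. by rewrite mem_filter mem_reading_cells => /andP[]. Qed.

Let S_sorted : pairwise reads_before S.
Proof. exact: pairwise_filter (reading_cells_sorted r c). Qed.

Let S_uniq : uniq S.
Proof.
apply: pairwise_uniq S_sorted => p; by rewrite /reads_before !ltnn andbF.
Qed.

Lemma colourable_rows t : colourable R t (rank_count Q g r c t) (map v S).
Proof.
exists [seq (v p, g p.1) | p <- S]; split.
- by rewrite /unzip1 -map_comp.
- move=> a at_; rewrite /colour_class filter_map -map_comp (sorted_pairwise Rm.1).
  rewrite pairwise_map.
  apply: (@sub_in_pairwise _ (fun p => (p \in S) && (g p.1 == a)) reads_before).
  + move=> [i j] [i' j'] /andP[pS /eqP pa] /andP[qS /eqP qa].
    have /andP[/= ir _] := S_rect pS; have /andP[/= i'r _] := S_rect qS.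
    have ii : i = i' by rewrite -(gK ir) -(gK i'r) pa qa.
    rewrite /reads_before ii ltnn eqxx /= => jj'.
    by apply: rows => //; rewrite -ii.
  + by apply/allP => p; rewrite mem_filter andbC.
  + exact: pairwise_filter.
- by rewrite count_map.
Qed.

(** A column read from bottom to top is decreasing, so it contains at most one
cell of each colour. A column with more than [t] cells meets each of the [t]
longest rows, and any other column lies inside them; in both cases these rows
contain at least as many cells of the column as the colouring covers. *)
Lemma colourable_bound t m : colourable R t m (map v S) -> m <= rank_count Q g r c t.
Proof.
case=> cw [cwv cwI <-].
(* View the colouring as a function on cells. *)
pose f p := nth 0 (unzip2 cw) (index p S).
have szcw : size cw = size S by rewrite -(size_map v) -cwv size_map.
have cwE : cw = [seq (v p, f p) | p <- S].
  apply: (@eq_from_nth _ (0, 0)) => [|k]; rewrite ?size_map // szcw => kS.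
  rewrite (nth_map (0, 0)) // /f index_uniq //.
  rewrite [LHS]surjective_pairing; congr (_, _).
    by rewrite -(nth_map _ 0 fst) ?szcw // -/(unzip1 _) cwv (nth_map (0, 0)).
  by rewrite -(nth_map _ 0 snd) ?szcw.
rewrite {1}cwE count_map.
have cls p q : p \in S -> q \in S -> f p < t -> f p = f q -> p.2 = q.2 -> p = q.
  move=> pS qS fpt fpq pq2; apply/eqP; apply: contraT => pq.
  have := cwI _ fpt; rewrite cwE /colour_class filter_map -map_comp.
  rewrite (sorted_pairwise Rm.1) pairwise_map.
  set S' := filter _ _ => S'R.
  have S'r : pairwise reads_before S' by apply: pairwise_filter.
  have pS' : p \in S' by rewrite mem_filter /= eqxx.
  have qS' : q \in S' by rewrite mem_filter /= -fpq eqxx.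
  have := pairwise_relI reads_before (relpre v R) S'.
  rewrite S'R S'r => /pairwise_mem/(_ pS' qS' pq).
  case: p q pS qS pq2 {pq pS' qS' fpt fpq S' S'R S'r} => [i j] [i' j'] /= pS qS jj.
  rewrite -{}jj in qS *; rewrite /reads_before /= !ltnn !andbF !orbF.
  case/orP => /andP[ii' /= Rv]; first by have := cols qS pS ii'; rewrite Rv.
  by have := cols pS qS ii'; rewrite Rv.
rewrite /rank_count !(@count_by_column _ c); do ?by move=> p /S_rect /andP[].
apply: leq_sum => -[j /= _] _; rewrite -!size_filter.
set X := filter _ _; set Y := filter _ _.
have [/hasP[p pS /andP[/eqP pj pt]]|no] :=
  boolP (has (fun p => (p.2 == j) && (t <= g p.1)) S).
  have /andP[pr _] := S_rect pS.
  have XS p' : p' \in X -> [/\ p' \in S, f p' < t & p'.2 = j].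
    by rewrite mem_filter => /andP[/andP[? /eqP ?]].
  have Xt : size X <= t.
    rewrite -(size_map f) -(size_iota 0 t); apply: uniq_leq_size.
      rewrite map_inj_in_uniq ?(filter_uniq _ S_uniq) // => x y.
      move=> /XS[xS xt xj] /XS[yS _ yj] xy.
      by apply: cls => //; rewrite xj yj.
    by move=> k /mapP[x /XS[_ xt _] ->]; rewrite mem_iota.
  apply: leq_trans Xt _; rewrite -(size_iota 0 t) -(size_map (fun k => (g k, j))).
  have kr k : k < t -> k < r.
    by move=> kt; apply: leq_trans kt (leq_trans pt (ltnW (g_lt pr))).
  apply: uniq_leq_size.
    rewrite map_inj_in_uniq ?iota_uniq // => k l; rewrite !mem_iota /= => kt lt [kl].
    by rewrite -(gK (kr _ kt)) kl gK ?kr.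
  move=> q /mapP[k]; rewrite mem_iota /= => kt ->; rewrite mem_filter /= gK ?kr //.
  rewrite kt eqxx; apply: (@g_closed p.1); first by rewrite -pj -surjective_pairing.
    by apply: g_lt; apply: kr.
  by rewrite gK ?kr //; apply: leq_trans (ltnW kt) pt.
apply: uniq_leq_size (filter_uniq _ S_uniq) _ => p.
rewrite mem_filter => /andP[/andP[_ pj] pS]; rewrite mem_filter pS pj !andbT.
by rewrite ltnNge; apply: contra no => pt; apply/hasP; exists p; rewrite ?pj.
Qed.

End Greene.

(** * Complementary shapes *)

Lemma count_row (Q : pred cell) i (s t : seq nat) : uniq s ->
  count (fun p => (p.1 == i) && Q p) [seq (k, j) | k <- s, j <- t] =
  if i \in s then count (fun j => Q (i, j)) t else 0.
Proof.
elim: s => //= k s IH /andP[ks /IH{}IH]; rewrite count_cat {}IH count_map inE.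
have [->|ki] := eqVneq i k.
  by rewrite (negPf ks) addn0; apply: eq_count => j /=; rewrite eqxx.
rewrite (@eq_count _ _ pred0) ?count_pred0 // => j /=.
by rewrite eq_sym (negPf ki).
Qed.

Lemma rank_countS (Q : pred cell) (g : nat -> nat) r c t :
    (forall i, i < r -> g (g i) = i) -> (forall i, i < r -> g i < r) -> t < r ->
  rank_count Q g r c t.+1 = rank_count Q g r c t +
  count (fun j => Q (g t, j)) (iota 0 c).
Proof.
move=> gK g_lt tr; rewrite /rank_count !count_filter.
have <- : count (fun p => (p.1 == g t) && Q p) (reading_cells r c) =
          count (fun j => Q (g t, j)) (iota 0 c).
  by rewrite count_row ?rev_uniq ?iota_uniq // mem_rev mem_iota g_lt.
rewrite -count_predUI [X in _ + X](_ : _ = 0) ?addn0.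
  apply: eq_in_count => p; rewrite mem_reading_cells => /andP[pr _] /=.
  rewrite -andb_orl ltnS leq_eqVlt orbC; congr ((_ || _) && _).
  by apply/eqP/eqP => [<-|->]; rewrite gK.
apply/eqP; rewrite -leqn0 leqNgt -has_count; apply/hasPn => p _ /=.
apply/negP => /andP[/andP[pt _] /andP[/eqP pE _]].
by rewrite pE gK // ltnn in pt.
Qed.

Lemma filter_reading_word r c T (P : pred nat) : rectangular r c T ->
  [seq x <- reading_word r c (board_of T) | P x] =
  [seq entry T p | p <- [seq p <- reading_cells r c | P (entry T p)]].
Proof.
move=> rT; rewrite reading_wordE.
have : all (in_rect r c) (reading_cells r c).
  by apply/allP => p; rewrite mem_reading_cells.
elim: (reading_cells r c) => //= p s IH /andP[prc /IH].
have -> : board_of T p = Some (entry T p) by rewrite /board_of (mem_cells_rect _ rT) prc.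
by move=> /= ->; case: ifP.
Qed.

(** The raising [h] of the letters makes it possible to compare words of different
stages of the promotion in one alphabet. *)
Lemma greene_interval delta r c T R (P : pred nat) (h g : nat -> nat) t m :
    mixed_order R -> mixed_tableau delta r c T ->
    (forall x y, 0 < x <= size delta -> 0 < y <= size delta -> P x -> P y ->
       orient_le delta x y = R (h x) (h y)) ->
    (forall i, i < r -> g (g i) = i) -> (forall i, i < r -> g i < r) ->
    (forall i i' j : nat, (i, j) \in cells T -> (i', j) \in cells T -> g i' <= g i ->
       P (entry T (i, j)) -> P (entry T (i', j))) ->
  let w := [seq h x | x <- reading_word r c (board_of T) & P x] in
  let m0 := rank_count (fun p => P (entry T p)) g r c t in
  colourable R t m0 w /\ (colourable R t m w -> m <= m0).
Proof.
move=> Rm mT hR gK g_lt gP w m0; have [rT range _] := mT.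
have inS p : p \in [seq p <- reading_cells r c | P (entry T p)] =
    P (entry T p) && (p \in cells T).
  by rewrite mem_filter mem_reading_cells (mem_cells_rect _ rT).
have -> : w = map (h \o entry T) [seq p <- reading_cells r c | P (entry T p)].
  by rewrite /w filter_reading_word // -map_comp.
have rows i j j' : (i, j) \in [seq p <- reading_cells r c | P (entry T p)] ->
    (i, j') \in [seq p <- reading_cells r c | P (entry T p)] -> j < j' ->
    R (h (entry T (i, j))) (h (entry T (i, j'))).
  rewrite !inS => /andP[Pp pT] /andP[Pq qT] jj'.
  by rewrite -hR ?range //; apply: mixed_row mT jj' qT.
have cols i i' j : (i, j) \in [seq p <- reading_cells r c | P (entry T p)] ->
    (i', j) \in [seq p <- reading_cells r c | P (entry T p)] -> i < i' ->
    ~~ R (h (entry T (i', j))) (h (entry T (i, j))).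
  rewrite !inS => /andP[Pp pT] /andP[Pq qT] ii'.
  by rewrite -hR ?range //; apply: mixed_col mT ii' qT.
have closed i i' j : (i, j) \in [seq p <- reading_cells r c | P (entry T p)] ->
    i' < r -> g i' <= g i -> (i', j) \in [seq p <- reading_cells r c | P (entry T p)].
  rewrite !inS => /andP[Pp pT] i'r gi.
  have qT : (i', j) \in cells T.
    by move: pT; rewrite !(mem_cells_rect _ rT) /in_rect /= i'r => /andP[].
  by rewrite qT andbT; apply: gP pT qT gi Pp.
split; first exact: colourable_rows.
apply: (colourable_bound Rm (v := h \o entry T)) => //; exact: closed.
Qed.

Definition row_length (c : nat) (T : filling) (k i : nat) : nat :=
  count (fun j => entry T (i, j) <= k) (iota 0 c).

Lemma mixed_col_le delta r c T i i' j : mixed_tableau delta r c T ->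
  i <= i' -> (i', j) \in cells T -> entry T (i, j) <= entry T (i', j).
Proof.
move=> mT; rewrite leq_eqVlt => /predU1P[-> //|ii' q].
exact: orient_le_geq (mixed_col mT ii' q).
Qed.

(** Greene's invariants are the partial sums of the row lengths, so their equality
for all t gives the equality of the individual rows. *)
Lemma promotions_complement delta r c k i T :
  mixed_tableau delta r c T -> k <= size delta -> i < r ->
  row_length c (promotions delta k T) (size delta - k) i =
  c - row_length c T k (r.-1 - i).
Proof.
move=> mT kn ir; have Rm := orient_le_mixed delta.
have [mTk K] := promotions_mixed mT kn.
set n := size delta in kn K *; set Tk := promotions delta k T in mTk K *.
have revK j : j < r -> r.-1 - (r.-1 - j) = j by lia.
have rev_lt j : j < r -> r.-1 - j < r by lia.
have shift x y : 0 < x <= size (iter k rotate delta) ->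
    0 < y <= size (iter k rotate delta) -> x <= n - k -> y <= n - k ->
    orient_le (iter k rotate delta) x y = orient_le delta (x + k) (y + k).
  by rewrite size_iter_rotate -/n => xn yn xk yk; rewrite orient_le_iter_rotate //; lia.
have straight (j j' l : nat) : (j, l) \in cells Tk -> (j', l) \in cells Tk -> j' <= j ->
    entry Tk (j, l) <= n - k -> entry Tk (j', l) <= n - k.
  by move=> pT _ jj'; apply: leq_trans; apply: mixed_col_le mTk jj' pT.
have antinormal (j j' l : nat) : (j, l) \in cells T -> (j', l) \in cells T ->
    r.-1 - j' <= r.-1 - j -> k < entry T (j, l) -> k < entry T (j', l).
  move=> pT qT jj' /leq_trans; apply; apply: (mixed_col_le mT) (qT).
  by move: pT qT jj'; rewrite !(mem_cells_rect _ (mixed_rect mT)) /in_rect /=; lia.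
have counts t : rank_count (fun p => entry Tk p <= n - k) id r c t =
    rank_count (fun p => k < entry T p) (fun j => r.-1 - j) r c t.
  have Kcol m := colourable_knuth t m Rm K.
  have /= [s1 s2] := greene_interval t
    (rank_count (fun p => k < entry T p) (fun j => r.-1 - j) r c t)
    Rm mTk shift (fun _ _ => erefl) (fun _ jr => jr) straight.
  have /= [a1 a2] := greene_interval (h := id) t
    (rank_count (fun p => entry Tk p <= n - k) id r c t)
    Rm mT (fun _ _ _ _ _ _ => erefl) revK rev_lt antinormal.
  rewrite map_id in a1 a2.
  by apply/eqP; rewrite eqn_leq a2 ?s2 //; apply/Kcol.
have := rank_countS (fun p => entry Tk p <= n - k) c (fun _ _ => erefl)
  (fun _ jr => jr) ir.
have := rank_countS (fun p => k < entry T p) c revK rev_lt ir.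
rewrite !counts /row_length => -> /addnI <-.
rewrite -{2}(size_iota 0 c) -(count_predC (fun j => entry T (r.-1 - i, j) <= k)) addKn.
by apply: eq_count => j /=; rewrite ltnNge.
Qed.

Lemma count_initial (P : pred nat) c j : (forall k l, k < l < c -> P l -> P k) ->
  j < c -> (j < count P (iota 0 c)) = P j.
Proof.
move=> Pc jc; rewrite (iota_split jc) count_cat /=.
have le_j : count P (iota 0 j) <= j by rewrite -{2}(size_iota 0 j) count_size.
have [Pj|Pj] := boolP (P j).
  have : all P (iota 0 j).
    by apply/allP => k; rewrite mem_iota => kj; apply: Pc Pj; lia.
  rewrite all_count => /eqP ->.
  by rewrite size_iota; lia.
have -> : count P (iota j.+1 (c - j.+1)) = 0; last by lia.
apply/eqP; rewrite -leqn0 leqNgt -has_count; apply/hasPn => k; rewrite mem_iota => jk.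
by apply: contra Pj; apply: Pc; lia.
Qed.

Lemma row_lengthP delta r c k i j T : mixed_tableau delta r c T -> in_rect r c (i, j) ->
  (j < row_length c T k i) = (entry T (i, j) <= k).
Proof.
move=> mT /andP[/= ir jc].
apply: (@count_initial (fun j => entry T (i, j) <= k)) => // l l' ll'.
apply: leq_trans; apply: orient_le_leq (mixed_row mT _ _).
  by case/andP: ll'.
by rewrite (mem_cells_rect _ (mixed_rect mT)) /in_rect ir /=; case/andP: ll'.
Qed.

Theorem theorem1 (n : nat) (delta : seq orientation) (T : filling) (r c : nat) :
  size delta = n ->
  shape T = nseq r c ->
  semistandard delta T ->
  promotions delta n T = T.
Proof.
move=> sd sT ssT; have mT := semistandard_mixed sT ssT.
have [mTn _] := promotions_mixed mT (leqnn _); rewrite sd in mTn.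
have lengths k i : k <= n -> i < r ->
    row_length c (promotions delta n T) k i = row_length c T k i.
  move=> kn ir; have kd : k <= size delta by rewrite sd.
  have [mTk _] := promotions_mixed mT kd.
  have nk : n - k <= size (iter k rotate delta) by rewrite size_iter_rotate sd leq_subr.
  have := promotions_complement mTk nk ir.
  rewrite size_iter_rotate sd subKn // -promotions_add subnKC // => ->.
  have := promotions_complement mT kd (_ : r.-1 - i < r).
  rewrite sd => -> //; last by lia.
  have -> : r.-1 - (r.-1 - i) = i by lia.
  by rewrite subKn // -{2}(size_iota 0 c) count_size.
have entries p : in_rect r c p -> entry (promotions delta n T) p = entry T p.
  case: p => i j prc; have /andP[/= ir _] := prc.
  have E k : k <= n ->
      (entry (promotions delta n T) (i, j) <= k) = (entry T (i, j) <= k).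
    by move=> kn; rewrite -(row_lengthP _ mTn prc) -(row_lengthP _ mT prc) lengths.
  have le_n : entry T (i, j) <= n.
    rewrite -(mem_cells_rect _ (mixed_rect mT)) in prc.
    by have := mixed_range mT prc; rewrite sd => /andP[].
  have le_n' : entry (promotions delta n T) (i, j) <= n by rewrite E.
  by apply/eqP; rewrite eqn_leq E // leqnn -E // leqnn.
have [sTn sTni] := mixed_rect mTn; have [sT' sTi] := mixed_rect mT.
apply: (@eq_from_nth _ [::]) => [|i]; first by rewrite sTn.
rewrite sTn => ir; apply: (@eq_from_nth _ 0) => [|j]; first by rewrite sTni ?sTi.
by rewrite sTni // => jc; apply: (entries (i, j)); apply/andP.
Qed.
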